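(* Let $s\in(1,2]$ and let $K\subseteq[0,1]$ be a compact set. If $f\in H_s(K)$ is a regular full-dimensional function, then there exists a compact subset $F\subseteq K$ such that (1) $\dim_H F=s-1$, and (2) $f$ is Lipschitz on $F$.
   Context: For compact $K\subseteq[0,1]$, $C(K)$ is the space of real-valued continuous functions on $K$, $G_f(X)=\{(x,f(x)):x\in X\}$, $\dim_H$ is Hausdorff dimension, $H_s(K)=\{f\in C(K):\dim_H G_f(K)=s\}$, and $B(x,r)$ is the open ball of center $x$ and radius $r$. For $f\in C(K)$, $x_0\in K$ and $\beta\in(0,+\infty)$, set $V_\beta=\{(x,y)\in\mathbb{R}^2: x\neq x_0,\ |(y-f(x_0))/(x-x_0)|\leq\beta\}$. The point $x_0$ is a $\beta$-regular full-dimensional point of $f$ if $\dim_H\big(V_\beta\cap G_f(K\cap B(x_0,r))\big)=\dim_H G_f(K)$ for every $r>0$. The function $f$ is regular full-dimensional if for some $\beta\in(0,+\infty)$ it has a $\beta$-regular full-dimensional point. *)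

(* Defs.v *)
From HB Require Import structures.
From mathcomp Require Import all_boot all_order all_algebra.
From mathcomp Require Import all_classical all_reals all_analysis.
Set Implicit Arguments. Unset Strict Implicit. Unset Printing Implicit Defensive.
Import Order.TTheory GRing.Theory Num.Theory.
Import numFieldNormedType.Exports.
Local Open Scope classical_set_scope.
Local Open Scope ring_scope.

Section Hausdorff.
Context {R : realType} {T : Type} (d : T -> T -> R).

Definition diam (U : set T) : \bar R :=
  if pselect (U = set0) then 0%E
  else ereal_sup [set (d x y)%:E | x in U & y in U].

Definition cover_term (t : R) (U : set T) : \bar R :=
  if pselect (U = set0) then 0%E else (powR (fine (diam U)) t)%:E.

Definition delta_cover (delta : R) (A : set T) (U : nat -> set T) : Prop :=
  A `<=` \bigcup_n U n /\ forall n, (diam (U n) <= delta%:E)%E.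

Definition hausdorff_content (t delta : R) (A : set T) : \bar R :=
  ereal_inf [set (\sum_(0 <= n <oo) cover_term t (U n))%E | U in delta_cover delta A].

(* H^t(A) = lim_{delta -> 0+} H^t_delta(A) = sup_{delta > 0} H^t_delta(A) *)
Definition hausdorff_measure (t : R) (A : set T) : \bar R :=
  ereal_sup [set hausdorff_content t delta A | delta in [set delta : R | 0 < delta]].

Definition hausdorff_dim (A : set T) : \bar R :=
  ereal_inf [set t%:E | t in [set t : R | 0 <= t /\ hausdorff_measure t A = 0%E]].
End Hausdorff.

Definition dist1 {R : realType} (x y : R) : R := `|x - y|.
Definition dist2 {R : realType} (p q : R * R) : R :=
  Num.sqrt ((p.1 - q.1) ^+ 2 + (p.2 - q.2) ^+ 2).

Definition dimH1 {R : realType} (A : set R) : \bar R := hausdorff_dim dist1 A.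
Definition dimH2 {R : realType} (A : set (R * R)) : \bar R := hausdorff_dim dist2 A.

Definition graph {R : realType} (f : R -> R) (X : set R) : set (R * R) :=
  [set (x, f x) | x in X].

Definition contK {R : realType} (K : set R) (f : R -> R) : Prop :=
  {within K, continuous f}.

Definition H_s {R : realType} (s : R) (K : set R) (f : R -> R) : Prop :=
  contK K f /\ dimH2 (graph f K) = s%:E.

Definition oball {R : realType} (x0 r : R) : set R := [set x | `|x - x0| < r].

Definition Vcone {R : realType} (f : R -> R) (x0 beta : R) : set (R * R) :=
  [set p | p.1 != x0 /\ `|(p.2 - f x0) / (p.1 - x0)| <= beta].

Definition beta_regular_fd_point {R : realType} (K : set R) (f : R -> R)
    (x0 beta : R) : Prop :=
  K x0 /\ forall r : R, 0 < r ->
    dimH2 (Vcone f x0 beta `&` graph f (K `&` oball x0 r)) = dimH2 (graph f K).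

Definition regular_full_dimensional {R : realType} (K : set R) (f : R -> R) : Prop :=
  exists beta : R, 0 < beta /\ exists x0 : R, beta_regular_fd_point K f x0 beta.

Definition lipschitz_on_set {R : realType} (F : set R) (f : R -> R) : Prop :=
  exists L : R, forall x y, F x -> F y -> `|f x - f y| <= L * `|x - y|.

(* Main.v *)
Require Import Defs.
From HB Require Import structures.
From mathcomp Require Import all_boot all_order all_algebra.
From mathcomp Require Import all_classical all_reals all_analysis.
From mathcomp Require Import ring lra zify.
Set Implicit Arguments. Unset Strict Implicit. Unset Printing Implicit Defensive.
Import Order.TTheory GRing.Theory Num.Theory.
Import numFieldNormedType.Exports.
Local Open Scope classical_set_scope.
Local Open Scope ring_scope.

(** Marstrand slicing, made finite. A greedy Frostman construction puts weights on a
2^-k-net of the graph, dyadic squares of side 2^-n getting mass at most 2^(-nt). Two points at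
distance d share a strip of width 2^-k in at most about 1/d of the 2^k slopes i/2^k, so on
average over strips at least half of the mass is carried by points around which the mass of the
strip is at most M 2^(-nu), where u < t - 1. Simultaneously, the expected number of boxes of size
r met by a strip is about r times the number of boxes, which keeps finite covers of the
graph at exponents s + 1/(q+1) cheap on the strip at exponents s - 1 + 1/(q+1). The limit of
the strips along a subsequence is a line whose intersection with the graph has positive
u-dimensional measure and dimension at most s - 1, and f is Lipschitz on that slice.

Exact dimension s - 1 is reached by a union of slices with u increasing to s - 1, taken in
dyadic shells around the regular point x0. The cone condition makes f Lipschitz across shells
that are two scales apart, and full dimension in every ball around x0 provides shells arbitrarily
close to x0 whose graph has dimension as close to s as needed. *)

(** * Covers by boxes *)

Definition box1 {R : realType} (p r : R) : set R := [set x | `|x - p| < r].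
Definition box2 {R : realType} (p : R * R) (r : R) : set (R * R) :=
  [set q | `|q.1 - p.1| < r /\ `|q.2 - p.2| < r].

(** Vanishing of the [t]-dimensional Hausdorff content for covers by boxes. For [t > 0] a small
    total cost forces small radii, so the notion agrees with a null Hausdorff measure although no
    bound on the radii is imposed. Bounded partial sums stand for the series. *)
Definition null {R : realType} {T : Type} (b : T -> R -> set T) (t : R) (A : set T) :=
  forall c : R, 0 < c -> exists (p : nat -> T) (r : nat -> R),
    [/\ forall n, 0 <= r n, A `<=` \bigcup_n b (p n) (r n)
      & forall N, \sum_(n < N) powR (r n) t <= c].

Lemma powR_mono {R : realType} (t x y : R) : 0 <= t -> 0 <= x -> x <= y ->
  powR x t <= powR y t.
Proof. by move=> t0 x0 xy; apply: ge0_ler_powR => //; rewrite nnegrE // (le_trans x0). Qed.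

Lemma powR_inj_le {R : realType} (t x y : R) : 0 < t -> 0 <= x -> 0 <= y ->
  powR x t <= powR y t -> x <= y.
Proof.
move=> t0 x0 y0 h; rewrite leNgt; apply/negP => yx.
have := @gt0_ltr_powR R t t0 y x; rewrite !nnegrE => /(_ y0 x0 yx).
by rewrite ltNge h.
Qed.

Lemma powRVK {R : realType} (t x : R) : t != 0 -> 0 <= x -> powR (powR x t^-1) t = x.
Proof. by move=> t0 x0; rewrite -powRrM mulVf // powRr1. Qed.

Lemma powR_anti {R : realType} (x s t : R) : 0 <= x <= 1 -> 0 <= s -> 0 < t -> s <= t ->
  powR x t <= powR x s.
Proof.
move=> /andP[x0 x1] s0 t0 st.
have [->|xn0] := eqVneq x 0.
  by rewrite powR0 ?gt_eqF// powR_ge0.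
rewrite -(subrKC s t) powRD; last by rewrite xn0 implybT.
have h : powR x (t - s) <= powR 1 (t - s) by rewrite powR_mono// subr_ge0.
by rewrite ler_piMr ?powR_ge0//; rewrite powR1 in h.
Qed.

Lemma null_subset {R : realType} {T : Type} (b : T -> R -> set T) t (A B : set T) :
  A `<=` B -> null b t B -> null b t A.
Proof.
move=> AB nB c c0; have [p [r [h1 h2 h3]]] := nB c c0.
by exists p, r; split => //; exact: subset_trans AB h2.
Qed.

Lemma powR_le1 {R : realType} (x t : R) : 0 < t -> 0 <= x -> powR x t <= 1 -> x <= 1.
Proof. by move=> t0 x0 h; apply: (@powR_inj_le _ t) => //; rewrite powR1. Qed.

Lemma sum_ge_term {R : realType} (a : nat -> R) n : (forall n, 0 <= a n) ->
  a n <= \sum_(i < n.+1) a i.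
Proof. by move=> a0; rewrite big_ord_recr /= lerDr sumr_ge0. Qed.

Lemma sum_geom_half {R : realType} (c : R) N : 0 <= c ->
  \sum_(n < N) c / 2 ^+ n.+1 <= c.
Proof.
move=> c0; suff -> : \sum_(n < N) c / 2 ^+ n.+1 = c - c / 2 ^+ N.
  by rewrite gerBl divr_ge0// exprn_ge0.
elim: N => [|N IH]; first by rewrite big_ord0 expr0 divr1 subrr.
rewrite big_ord_recr /= IH exprS; field; exact/expf_neq0.
Qed.

Lemma null_bigcup {R : realType} {T : Type} (b : T -> R -> set T) t (A : nat -> set T) :
  inhabited T -> 0 < t -> (forall n, null b t (A n)) -> null b t (\bigcup_n A n).
Proof.
move=> [x0] t0 nA c c0.
have cn n : 0 < c / 2 ^+ n.+1 by rewrite divr_gt0// exprn_gt0.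
have /choice[p hp] : forall n, exists p : nat -> T, exists r : nat -> R,
  [/\ forall n, 0 <= r n, A n `<=` \bigcup_n b (p n) (r n)
      & forall N, \sum_(n < N) powR (r n) t <= c / 2 ^+ n.+1] by move=> n; exact: nA.
have /choice[r hr] := hp.
(* The double family of boxes is listed through the coding of pairs; a number that codes no pair
   gets radius 0, which costs nothing because [t > 0]. *)
pose P k := if @pickle_inv (nat * nat)%type k is Some u then p u.1 u.2 else x0.
pose Q k := if @pickle_inv (nat * nat)%type k is Some u then r u.1 u.2 else 0.
exists P, Q; split.
- move=> k; rewrite /Q; case: pickle_inv => // u; by case: (hr u.1) => h _ _; apply: h.
- move=> x [n _ Ax]; have [_ h _] := hr n; have {h} [m _ bx] := h x Ax.
  by exists (pickle (n, m)) => //; rewrite /P /Q pickleK_inv.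
- move=> N.
  pose a n m := powR (r n m) t.
  have a0 n m : 0 <= a n m by exact: powR_ge0.
  (* The first [N] codes only involve pairs in a finite square, so the partial sum is at most a
     finite double sum. *)
  have [M hM] : exists M, forall k u, (k < N)%N -> @pickle_inv (nat * nat)%type k = Some u ->
      (u.1 < M)%N /\ (u.2 < M)%N.
    elim: N => [|N [M hM]]; first by exists 0%N.
    case E : (@pickle_inv (nat * nat)%type N) => [v|].
      exists (maxn M (maxn v.1 v.2).+1) => k u; rewrite ltnS leq_eqVlt => /predU1P[->|kN].
        rewrite E => -[<-]; lia.
      move=> /(hM _ _ kN); lia.
    exists M => k u; rewrite ltnS leq_eqVlt => /predU1P[->|kN]; first by rewrite E.
    exact: hM.
  have QE (k : 'I_N) : powR (Q k) t =
      \sum_(n < M) \sum_(m < M) (if @pickle_inv (nat * nat)%type k == Some (n : nat, m : nat) then a n m else 0).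
    rewrite /Q; case E : (@pickle_inv (nat * nat)%type k) => [u|]; last first.
      rewrite powR0 ?gt_eqF// big1// => n _; rewrite big1// => m _.
    have [u1 u2] := hM _ _ (ltn_ord k) E.
    rewrite (bigD1 (Ordinal u1))//= (bigD1 (Ordinal u2))//= -surjective_pairing eqxx.
    rewrite [X in _ + X + _]big1 ?addr0; last first.
      move=> m; rewrite -val_eqE /= => mu; case: eqP => // -[] E1.
      by move: mu; rewrite E1 /= eqxx.
    rewrite big1 ?addr0// => n; rewrite -val_eqE /= => nu; rewrite big1// => m _.
    by case: eqP => // -[] E1; move: nu; rewrite E1 /= eqxx.
  rewrite (eq_bigr _ (fun k _ => QE k)) exchange_big /=.
  apply: le_trans (_ : \sum_(n < M) c / 2 ^+ n.+1 <= _); last exact/sum_geom_half/ltW.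
  apply: ler_sum => n _; rewrite exchange_big /=.
  have [_ _ h] := hr n; apply: le_trans (h M); apply: ler_sum => m _.
  rewrite -big_mkcond /=.
  case: (pickP (fun k : 'I_N => @pickle_inv (nat * nat)%type k == Some (n : nat, m : nat))) => [k hk|no].
    rewrite (big_pred1 k)// => k' /=; apply/idP/eqP => [/eqP h'|->//]; apply/val_inj.
    have e1 := @pickle_invK (nat * nat)%type k'; have e2 := @pickle_invK (nat * nat)%type k.
    by rewrite h' in e1; rewrite (eqP hk) in e2; exact: etrans (esym e1) e2.
  by rewrite big_pred0 ?a0.
Qed.

(** A set of diameter [D] lies in a box of radius [D + e n] around any of its points; the
    enlargement is there because boxes are open, and its cost is geometrically small. Passing from
    [s] to [t] uses diameters at most 1. *)
Lemma hausdorff_measure_null {R : realType} {T : Type} (d : T -> T -> R)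
    (b : T -> R -> set T) (s t : R) (A : set T) :
  inhabited T -> (forall x y, 0 <= d x y) -> (forall p r x, d p x < r -> b p r x) ->
  0 <= s -> s <= t -> 0 < t ->
  hausdorff_measure d s A = 0%E -> null b t A.
Proof.
move=> [x0] d0 db s0 st t0 HA c c0.
have k0 : 0 < powR 2 t :> R by rewrite powR_gt0.
(* The factor [powR 2 t] pays for bounding the power of [D + e] by the powers of [D] and [e], the
   factor 2 for the two resulting sums. *)
pose c1 := c / (powR 2 t * 2).
have c10 : 0 < c1 by rewrite divr_gt0// mulr_gt0.
have : (hausdorff_content d s 1 A < c1%:E)%E.
  apply: (@le_lt_trans _ _ 0%E); last by rewrite lte_fin.
  by rewrite -HA; apply: ereal_sup_ubound; exists 1 => //=.
move=> /ereal_inf_lt[_ [U [AU Ud] <-]] Uc.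
pose e n := powR (c1 / 2 ^+ n.+1) t^-1.
have eE n : powR (e n) t = c1 / 2 ^+ n.+1.
  by rewrite /e powRVK ?gt_eqF// divr_ge0 ?(ltW c10)// exprn_ge0.
have dge n x y : U n x -> U n y -> ((d x y)%:E <= diam d (U n))%E.
  move=> Ux Uy; rewrite /diam; case: pselect => /= [U0|_]; first by rewrite U0 in Ux.
  by apply: ereal_sup_ubound; exists x => //; exists y.
have dfin n : diam d (U n) \is a fin_num.
  rewrite fin_numE; apply/andP; split.
    rewrite /diam; case: pselect => /= [//|/eqP/set0P[x Ux]].
    rewrite gt_eqF// (lt_le_trans (ltNyr (d x x)))//.
    by have := dge n x x Ux Ux; rewrite /diam; case: pselect => // U0; rewrite U0 in Ux.
  by rewrite lt_eqF// (le_lt_trans (Ud n))// ltry.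
have d_ge0 n : 0 <= fine (diam d (U n)).
  rewrite fine_ge0// /diam; case: pselect => /= [//|/eqP/set0P[x Ux]].
  have := dge n x x Ux Ux; rewrite /diam; case: pselect => /= [U0|_]; first by rewrite U0 in Ux.
  by apply: le_trans; rewrite lee_fin.
have Une n : exists p, U n `<=` b p (fine (diam d (U n)) + e n).
  have [->|/set0P[p Up]] := eqVneq (U n) set0; first by exists x0.
  exists p => x Ux; apply: db; apply: (@le_lt_trans _ _ (fine (diam d (U n)))).
    by rewrite -lee_fin fineK//; exact: dge.
  by rewrite ltrDl powR_gt0// divr_gt0// exprn_gt0.
have /choice[p hp] := Une.
have ct n : (0 <= cover_term d s (U n))%E.
  by rewrite /cover_term; case: pselect => /= _ //; rewrite lee_fin powR_ge0.
exists p, (fun n => if pselect (U n = set0) then e n else fine (diam d (U n)) + e n); split.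
- by move=> n; case: pselect => /= _; rewrite ?addr_ge0 ?powR_ge0.
- move=> x /AU[n _ Ux]; exists n => //=; case: pselect => /= [U0|_]; last exact: hp.
  by rewrite U0 in Ux.
- move=> N.
  have sc : \sum_(n < N) (fine (cover_term d s (U n))) <= c1.
    rewrite -lee_fin -sumEFin; apply: le_trans (ltW Uc).
    rewrite (eq_bigr (fun n : 'I_N => cover_term d s (U n))) => [|n _]; last first.
      by rewrite fineK// /cover_term; case: pselect.
    rewrite -(big_mkord xpredT (fun n => cover_term d s (U n))).
    by apply: nneseries_lim_ge.
  have -> : c = powR 2 t * (c1 + c1) by rewrite /c1; field; rewrite gt_eqF.
  apply: (@le_trans _ _ (\sum_(n < N) powR 2 t * (fine (cover_term d s (U n)) + c1 / 2 ^+ n.+1))).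
    apply: ler_sum => n _; rewrite -eE /cover_term.
    case: pselect => /= [U0|U0] /=.
      by rewrite add0r ler_peMl ?powR_ge0//; have := @powR_mono R t 1 2; rewrite powR1; apply; lra.
    set D := fine _.
    have h1 : powR D t <= powR D s.
      apply: powR_anti => //; rewrite d_ge0 /=.
      by rewrite -lee_fin fineK.
    have e0 : 0 <= e n by exact: powR_ge0.
    have D0 : 0 <= D := d_ge0 n.
    move: (e n) e0 => E E0; clearbody D.
    apply: (@le_trans _ _ (powR 2 t * (powR D t + powR E t))); last by rewrite ler_pM2l// lerD2r.
    have [De|De] := leP D E.
      apply: (@le_trans _ _ (powR (2 * E) t)); first by apply: powR_mono; lra.
      by rewrite powRM// ler_pM2l// lerDr powR_ge0.
    apply: (@le_trans _ _ (powR (2 * D) t)); first by apply: powR_mono; lra.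
    by rewrite powRM// ler_pM2l// lerDl powR_ge0.
  by rewrite -mulr_sumr ler_pM2l// big_split /= lerD// sum_geom_half// ltW.
Qed.

(** Each radius is controlled by the total cost, so a cheap enough cover is automatically a
    [delta]-cover. *)
Lemma null_hausdorff_measure {R : realType} {T : Type} (d : T -> T -> R)
    (b : T -> R -> set T) (t : R) (A : set T) :
  (forall x y, 0 <= d x y) -> (forall p r x y, b p r x -> b p r y -> d x y <= 4 * r) ->
  0 < t -> null b t A -> hausdorff_measure d t A = 0%E.
Proof.
move=> d0 bd t0 nA.
have ct U : (0 <= cover_term d t U)%E.
  by rewrite /cover_term; case: pselect => /= _ //; rewrite lee_fin powR_ge0.
suff H delta : 0 < delta -> hausdorff_content d t delta A = 0%E.
  apply/eqP; rewrite eq_le; apply/andP; split.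
    by apply/ereal_supP => _ [e /= e0 <-]; rewrite H.
  by apply: ereal_sup_ubound; exists 1 => /=; [exact: ltr01|exact: H].
move=> de0; apply/eqP; rewrite eq_le; apply/andP; split; last first.
  by apply/ereal_infP => _ [U _ <-]; apply: nneseries_ge0.
apply/lee_addgt0Pr => c c0; rewrite add0e.
have k0 : 0 < powR 4 t :> R by rewrite powR_gt0.
(* The first bound absorbs the factor 4 between radius and diameter, the second forces
   [4 * r n <= delta]. *)
pose c1 := Num.min (c / powR 4 t) (powR (delta / 4) t).
have [|p [r [r0 Ar rs]]] := nA c1.
  by rewrite lt_min divr_gt0//= powR_gt0// divr_gt0.
have rd n : 4 * r n <= delta.
  rewrite mulrC -ler_pdivlMr//; apply: (@powR_inj_le _ t) => //; first by rewrite divr_ge0// ltW.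
  apply: le_trans (_ : c1 <= _); last by rewrite ge_min lexx orbT.
  apply: le_trans (rs n.+1).
  by apply: (@sum_ge_term _ (fun i => powR (r i) t)) => i; exact: powR_ge0.
have dr n : (diam d (b (p n) (r n)) <= (4 * r n)%:E)%E.
  rewrite /diam; case: pselect => /= _; first by rewrite lee_fin mulr_ge0.
  by apply/ereal_supP => _ [x bx [y By <-]]; rewrite lee_fin; exact: bd bx By.
apply: (@le_trans _ _ (\sum_(0 <= n <oo) cover_term d t (b (p n) (r n)))%E).
  apply: ereal_inf_lbound; exists (fun n => b (p n) (r n)) => //; split => // n.
  by apply: le_trans (dr n) _; rewrite lee_fin.
apply: lime_le; first exact: is_cvg_nneseries.
apply: nearW => N; rewrite big_mkord.
have term n : (cover_term d t (b (p n) (r n)) <= (powR 4 t * powR (r n) t)%:E)%E.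
  rewrite /cover_term; case: pselect => /= [_|/eqP/set0P[x bx]].
    by rewrite lee_fin mulr_ge0 ?powR_ge0.
  rewrite lee_fin -powRM//; apply: powR_mono; first exact: ltW.
  - rewrite fine_ge0//; apply: (@le_trans _ _ (d x x)%:E); first by rewrite lee_fin.
    rewrite /diam; case: pselect => /= [U0|_]; first by rewrite U0 in bx.
    by apply: ereal_sup_ubound; exists x => //; exists x.
  - have := dr n; case: (diam d _) => [y| |] /= h; [by rewrite -lee_fin|by rewrite mulr_ge0|by rewrite mulr_ge0].
apply: (@le_trans _ _ (\sum_(n < N) (powR 4 t * powR (r n) t)%:E)%E); first exact: lee_sum.
rewrite sumEFin lee_fin -mulr_sumr; apply: (@le_trans _ _ (powR 4 t * c1)).
  by rewrite ler_pM2l.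
by rewrite mulrC -ler_pdivlMr// ge_min lexx.
Qed.

(** * Finite Frostman weights *)

Lemma sum_nth_le {R : realType} (T : Type) (x0 : T) (g : T -> R) (L : seq T) N :
  (forall u, 0 <= g u) -> g x0 = 0 -> \sum_(i < N) g (nth x0 L i) <= \sum_(u <- L) g u.
Proof.
move=> g0 gx0; elim: L N => [|u L IH] N.
  by rewrite big_nil big1// => i _; rewrite nth_nil.
case: N => [|N]; first by rewrite big_ord0 sumr_ge0.
by rewrite big_ord_recl big_cons /= lerD2l; exact: IH.
Qed.

(** A finite cover is padded with boxes of radius 0, which are free for [t > 0]. *)
Lemma null_of_list {R : realType} {T : eqType} (b : T -> R -> set T) t (A : set T) :
  inhabited T -> 0 < t ->
  (forall c, 0 < c -> exists L : seq (T * R), [/\ forall u, u \in L -> 0 <= u.2,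
     forall x, A x -> exists2 u, u \in L & b u.1 u.2 x
     & \sum_(u <- L) powR u.2 t <= c]) ->
  null b t A.
Proof.
move=> [x0] t0 h c c0; have [L [L0 LA Lc]] := h c c0.
exists (fun i => (nth (x0, 0) L i).1), (fun i => (nth (x0, 0) L i).2); split.
- move=> i; have [iL|iL] := ltnP i (size L); last by rewrite nth_default.
  by apply: L0; rewrite mem_nth.
- move=> x /LA[u uL bu]; exists (index u L) => //=; by rewrite nth_index.
- move=> N; apply: le_trans Lc.
  apply: (@sum_nth_le _ _ (x0, 0) (fun u : T * R => powR u.2 t)) => /= [u|].
    exact: powR_ge0.
  by rewrite powR0// gt_eqF.
Qed.

Lemma not_null_list {R : realType} {T : eqType} (b : T -> R -> set T) t (A : set T) :
  inhabited T -> 0 < t -> ~ null b t A ->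
  exists2 c : R, 0 < c & forall L : seq (T * R), (forall u, u \in L -> 0 <= u.2) ->
     (forall x, A x -> exists2 u, u \in L & b u.1 u.2 x) -> c <= \sum_(u <- L) powR u.2 t.
Proof.
move=> iT t0 nA; apply: contrapT => h; apply: nA; apply: null_of_list => // c c0.
apply: contrapT => h'; apply: h; exists c => // L L0 LA; rewrite leNgt; apply/negP => Lc.
by apply: h'; exists L; split => //; exact: ltW.
Qed.

(** * Dyadic squares and greedy weights *)

Definition cell {R : realType} (n : nat) (x : R) : int := Num.floor (2 ^+ n * x).
Definition cell2 {R : realType} (f : R -> R) (n : nat) (x : R) : int * int :=
  (cell n x, cell n (f x)).
(** A list of pairs [(x, w)] stands for the measure on the graph with an atom of weight [w] at each
    point [(x, f x)]. *)
Definition mass {R : realType} (f : R -> R) (W : seq (R * R)) (n : nat) (c : int * int) : R :=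
  \sum_(v <- W | cell2 f n v.1 == c) v.2.

Lemma cell_coarsen1 {R : realType} n (x y : R) : cell n.+1 x = cell n.+1 y -> cell n x = cell n y.
Proof.
rewrite /cell !exprS -!mulrA; move: (2 ^+ n * x) (2 ^+ n * y) => {}x {}y.
wlog xy : x y / Num.floor x <= Num.floor y.
  move=> H h; have [xy|xy] := leP (Num.floor x) (Num.floor y); first exact: H.
  by symmetry; apply: H => //; exact: ltW.
move=> h; apply/eqP; rewrite eq_le xy /= leNgt; apply/negP => lt_xy.
have /andP[_ h1] := floor_itv x; have /andP[h2 _] := floor_itv y.
have /andP[_ h3] := floor_itv (2 * x); have /andP[h4 h5] := floor_itv (2 * y).
have h6 : (Num.floor x + 1)%:~R <= (Num.floor y)%:~R :> R by rewrite ler_int; lia.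
have : 2 * (Num.floor x + 1) <= Num.floor (2 * y).
  rewrite floor_ge_int rmorphM /=; move: h6 h2; rewrite /= ; lra.
have : Num.floor (2 * x) < 2 * (Num.floor x + 1).
  by rewrite floor_lt_int rmorphM /=; lra.
by rewrite h; lia.
Qed.

Lemma cell2_coarsen {R : realType} (f : R -> R) n k (x y : R) : (n <= k)%N ->
  cell2 f k x = cell2 f k y -> cell2 f n x = cell2 f n y.
Proof.
move=> /subnKC <-; elim: (k - n)%N => [|m IH]; first by rewrite addn0.
rewrite addnS => h; apply: IH; case: h => h1 h2.
by rewrite /cell2 (cell_coarsen1 h1) (cell_coarsen1 h2).
Qed.

Lemma cell_dist {R : realType} n (x y : R) : cell n x = cell n y -> `|x - y| < 2 ^- n.
Proof.
move=> h; have p0 : 0 < 2 ^+ n :> R by rewrite exprn_gt0.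
rewrite -(ltr_pM2l p0) mulfV ?gt_eqF// -{1}(gtr0_norm p0) -normrM mulrBr.
have := floor_itv (2 ^+ n * x); have := floor_itv (2 ^+ n * y).
rewrite -/(cell n x) -/(cell n y) h rmorphD /= => h1 h2.
rewrite ltr_norml; lra.
Qed.

(** Points are added one at a time, each with the largest weight that keeps its squares of levels up
    to [k] within their capacities [th ^+ n]. That weight saturates a square around the new point,
    and saturated squares stay saturated. *)
Lemma frostman_greedy {R : realType} (f : R -> R) (th : R) k (P : seq R) : 0 <= th ->
  exists W : seq (R * R), [/\ forall v, v \in W -> v.1 \in P /\ 0 <= v.2,
    forall n c, (n <= k)%N -> mass f W n c <= th ^+ n
    & forall x, x \in P -> exists2 n, (n <= k)%N & th ^+ n <= mass f W n (cell2 f n x)].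
Proof.
move=> th0; elim: P => [|x P [W [W0 Wm Ws]]].
  by exists [::]; split => // n c _; rewrite /mass big_nil exprn_ge0.
pose g (n : 'I_k.+1) := th ^+ n - mass f W n (cell2 f n x).
have g0 n : 0 <= g n by rewrite subr_ge0 Wm// -ltnS.
have [n0 hn0] : exists n0, forall n, g n0 <= g n.
  by case: (@arg_minP _ _ _ ord0 xpredT g) => // i _ hi; exists i => n; exact: hi.
have mE n c : mass f ((x, g n0) :: W) n c =
    (if cell2 f n x == c then g n0 else 0) + mass f W n c.
  by rewrite /mass big_cons /=; case: ifP => // _; rewrite add0r.
exists ((x, g n0) :: W); split.
- move=> v; rewrite inE => /predU1P[->|/W0[vP v0]]; first by split; [exact: mem_head|exact: g0].
  by rewrite inE vP orbT.
- move=> n c nk; rewrite mE; case: eqP => [<-|_]; last by rewrite add0r Wm.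
  have nk' : (n < k.+1)%N by rewrite ltnS.
  by have := hn0 (Ordinal nk'); rewrite {2}/g /= lerBrDr.
- move=> y; rewrite inE => /predU1P[->|/Ws[n nk h]].
    exists (n0 : nat); first by rewrite -ltnS.
    by rewrite mE eqxx /g subrK.
  by exists n => //; rewrite mE (le_trans h)// lerDr; case: ifP.
Qed.

(** Double counting: a point matches at most one label of [s]. *)
Lemma sum_count_le {R : realType} (S : eqType) (T : Type) (s : seq S) (W : seq (T * R))
    (m : S -> T -> bool) : uniq s ->
  (forall v, v \in [seq w.2 | w <- W] -> 0 <= v) ->
  (forall a b x, a \in s -> b \in s -> m a x -> m b x -> a = b) ->
  \sum_(a <- s) \sum_(v <- W | m a v.1) v.2 <= \sum_(v <- W) v.2.
Proof.
move=> us W0 inj; rewrite (eq_bigr _ (fun a _ => big_mkcond _ _)) exchange_big /=.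
elim: W W0 => [|v W IH] W0; first by rewrite !big_nil.
have v0 : 0 <= v.2 by apply: W0; rewrite mem_head.
rewrite !big_cons lerD//; last by apply: IH => u uW; apply: W0; rewrite inE uW orbT.
have [/hasP[a as_ ma]|no] := boolP (has (fun a => m a v.1) s); last first.
  rewrite big1_seq// => a /andP[_ as_]; case: ifP => // ma.
  by case/hasP: no; exists a.
rewrite (bigD1_seq a)//= ma big1_seq ?addr0// => b /andP[ba bs]; case: ifP => // mb.
by move: ba; rewrite (inj b a v.1 bs as_ mb ma) eqxx.
Qed.

(** The maximal saturated squares cover [E] and are disjoint, so their capacities add up to at most
    the total weight. *)
Lemma frostman_cover {R : realType} (f : R -> R) (th : R) k (P : seq R) (W : seq (R * R))
    (E : set R) :
  (forall v, v \in W -> 0 <= v.2) ->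
  (forall x, x \in P -> exists2 n, (n <= k)%N & th ^+ n <= mass f W n (cell2 f n x)) ->
  (forall x, E x -> exists2 p, p \in P & cell2 f k p = cell2 f k x) ->
  exists L : seq (R * nat),
    (forall x, E x -> exists2 u, u \in L & box2 (u.1, f u.1) (2 ^- u.2) (x, f x)) /\
    \sum_(u <- L) th ^+ u.2 <= \sum_(v <- W) v.2.
Proof.
move=> W0 Ps PE.
pose sat x n := (n <= k)%N && (th ^+ n <= mass f W n (cell2 f n x)).
(* [l x] is the coarsest level at which the square of [x] is saturated. *)
have /choice[l hl] : forall x, exists l, x \in P -> sat x l /\ forall n, sat x n -> (l <= n)%N.
  move=> x; have [/Ps[n nk h]|_] := boolP (x \in P); last by exists 0%N.
  have ex : exists n, sat x n by exists n; rewrite /sat nk.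
  by exists (ex_minn ex) => _; case: ex_minnP => m h1 h2.
pose s := undup [seq (l x, cell2 f (l x) x) | x <- P].
pose pt (a : nat * (int * int)) := nth 0 P (find (fun p => cell2 f a.1 p == a.2) P).
exists [seq (pt a, a.1) | a <- s]; split.
  move=> x /PE[p pP e]; have [/andP[lk _] _] := hl _ pP.
  have as_ : (l p, cell2 f (l p) p) \in s by rewrite mem_undup; exact: map_f.
  exists (pt (l p, cell2 f (l p) p), l p); first by apply/mapP; exists (l p, cell2 f (l p) p).
  have : cell2 f (l p) (pt (l p, cell2 f (l p) p)) = cell2 f (l p) x.
    rewrite -(cell2_coarsen lk e); apply/eqP; rewrite /pt /=.
    by apply: (@nth_find _ 0 (fun q => cell2 f (l p) q == cell2 f (l p) p)); apply/hasP; exists p.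
  by move=> [h1 h2]; split => /=; rewrite cell_dist.
rewrite big_map /=; apply: (@le_trans _ _ (\sum_(a <- s) mass f W a.1 a.2)).
  rewrite !big_seq; apply: ler_sum => a; rewrite mem_undup => /mapP[x xP ->] /=.
  by have [/andP[_ h] _] := hl _ xP.
apply: (@sum_count_le _ _ _ s W (fun a x => cell2 f a.1 x == a.2)).
- exact: undup_uniq.
- by move=> _ /mapP[v vW ->]; exact: W0.
- move=> a b y; rewrite !mem_undup => /mapP[x xP ->] /mapP[x' xP' ->] /= /eqP e /eqP e'.
  have [/andP[s1 s2] m1] := hl _ xP; have [/andP[s1' s2'] m1'] := hl _ xP'.
  (* Two chosen squares with a common point are nested; the coarser one is then a saturated square
     of both centers, and minimality of [l] makes the levels equal. *)
  have main (u u' : R) : u \in P -> u' \in P -> (l u <= l u')%N ->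
      cell2 f (l u) y = cell2 f (l u) u -> cell2 f (l u') y = cell2 f (l u') u' -> l u = l u'.
    move=> uP uP' uu' c1 c2; apply/eqP; rewrite eqn_leq uu' /=.
    have [/andP[q1 q2] _] := hl _ uP; have [_ q3] := hl _ uP'; apply: q3.
    by rewrite /sat q1 /= -(cell2_coarsen uu' c2) c1.
  have ll : l x = l x'.
    have [xx'|xx'] := leqP (l x) (l x'); first exact: main.
    by symmetry; apply: main => //; exact: ltnW.
  by rewrite -e -e' ll.
Qed.

Lemma floor_list {R : realType} (M : nat) :
  exists C : seq int, forall z : R, `|z| <= M%:R -> Num.floor z \in C.
Proof.
exists [seq i%:Z - M%:Z | i <- iota 0 (M + M).+1] => z; rewrite ler_norml => /andP[z1 z2].
have h1 : - M%:Z <= Num.floor z by rewrite floor_ge_int rmorphN.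
have h2 : Num.floor z <= M%:Z.
  by rewrite -(ler_int R); apply: le_trans z2; exact: floor_le.
apply/mapP; exists (absz (Num.floor z + M%:Z)); last by rewrite gez0_abs; lia.
by rewrite mem_iota; lia.
Qed.

(** Only finitely many squares of side 2^-k can meet the bounded graph; one point of [E] is picked
    in each square that does. *)
Lemma cell_net {R : realType} (f : R -> R) k (E : set R) (B : nat) :
  (forall x, E x -> `|x| <= B%:R /\ `|f x| <= B%:R) ->
  exists P : seq R, (forall p, p \in P -> E p) /\
    forall x, E x -> exists2 p, p \in P & cell2 f k p = cell2 f k x.
Proof.
move=> EB.
have [C hC] := @floor_list R (2 ^ k * B).
suff [P [PE h]] : exists P : seq R, (forall p, p \in P -> E p) /\
    forall x, E x -> cell2 f k x \in [seq (a, b) | a <- C, b <- C] ->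
      exists2 p, p \in P & cell2 f k p = cell2 f k x.
  exists P; split => // x Ex; apply: h => //; apply: allpairs_f.
    apply: hC; have [h _] := EB _ Ex.
    by rewrite normrM natrM natrX ger0_norm ?exprn_ge0// ler_pM2l// exprn_gt0.
  apply: hC; have [_ h] := EB _ Ex.
  by rewrite normrM natrM natrX ger0_norm ?exprn_ge0// ler_pM2l// exprn_gt0.
elim: [seq _ | _ <- _, _ <- _] => [|c D [P [PE h]]]; first by exists [::].
have [[y [Ey yc]]|no] := pselect (exists y, E y /\ cell2 f k y = c).
  exists (y :: P); split=> [p|x Ex].
    by rewrite inE => /predU1P[->|/PE].
  rewrite inE => /predU1P[xc|/(h x Ex)[p pP e]]; first by exists y; rewrite ?mem_head// yc.
  by exists p => //; rewrite inE pP orbT.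
exists P; split => // x Ex; rewrite inE => /predU1P[xc|]; last exact: h.
by exfalso; apply: no; exists x.
Qed.

Lemma powR2_expn {R : realType} (t : R) n : powR (2 ^- n) t = powR 2 (- t) ^+ n.
Proof.
by rewrite -(@powR_invn R 2 n)// -powRrM mulNr mulrC -mulNr powRrM powR_mulrn ?powR_ge0.
Qed.

(** The constant [c] is the least cost of finite covers given by non-nullity. The saturated squares
    form such a cover, so the total weight is at least [c], uniformly in [k]. *)
Lemma frostman {R : realType} (f : R -> R) (t : R) (E : set R) (B : nat) : 0 < t ->
  (forall x, E x -> `|x| <= B%:R /\ `|f x| <= B%:R) ->
  ~ null box2 t (graph f E) ->
  exists2 c : R, 0 < c & forall k, exists W : seq (R * R),
    [/\ forall v, v \in W -> E v.1 /\ 0 <= v.2,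
        forall n a, (n <= k)%N -> mass f W n a <= powR 2 (- t) ^+ n
      & c <= \sum_(v <- W) v.2].
Proof.
move=> t0 EB nE; have [c c0 hc] := not_null_list (inhabits (0, 0)) t0 nE.
exists c => // k; have [P [PE hP]] := cell_net k EB.
have [W [W1 W2 W3]] := @frostman_greedy R f (powR 2 (- t)) k P (powR_ge0 _ _).
exists W; split => //; first by move=> v /W1[/PE].
have [|L [L1 L2]] := frostman_cover (E := E) _ W3 hP; first by move=> v /W1[].
apply: le_trans L2.
rewrite (eq_bigr (fun u : R * nat => powR (2 ^- u.2) t)); last by move=> u _; rewrite powR2_expn.
rewrite -(big_map (fun u : R * nat => ((u.1, f u.1), 2 ^- u.2)) xpredT (fun w => powR w.2 t)).
apply: hc => [_ /mapP[u uL ->] /=|_ [x Ex <-]]; first by rewrite invr_ge0 exprn_ge0.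
have [u uL h] := L1 _ Ex; exists ((u.1, f u.1), 2 ^- u.2) => //.
by apply/mapP; exists u.
Qed.

(** Points this close have cell indices differing by at most 2 in each coordinate, which leaves 25
    squares. *)
Lemma mass_ball {R : realType} (f : R -> R) (W : seq (R * R)) n (x D : R) :
  (forall v, v \in W -> 0 <= v.2) -> (forall a, mass f W n a <= D) ->
  \sum_(v <- W | (`|v.1 - x| <= 2 * 2 ^- n) && (`|f v.1 - f x| <= 2 * 2 ^- n)) v.2 <= 25 * D.
Proof.
move=> W0 WD.
pose O : seq int := [:: -2; -1; 0; 1; 2].
have cO (y z : R) : `|y - z| <= 2 * 2 ^- n -> cell n y - cell n z \in O.
  have p0 : 0 < 2 ^+ n :> R by rewrite exprn_gt0.
  rewrite -(ler_pM2l p0) mulrCA mulfV ?gt_eqF// -{1}(gtr0_norm p0) -normrM mulrBr mulr1.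
  rewrite /cell; move: (_ * y) (_ * z) => {}y {}z; rewrite ler_norml => /andP[h1 h2].
  have /andP[a1 a2] := floor_itv y; have /andP[b1 b2] := floor_itv z.
  have e1 : (Num.floor y) < (Num.floor z + 1) + 2.
    by rewrite floor_lt_int [X in _ < X]rmorphD /=; lra.
  have e2 : (Num.floor z) < (Num.floor y + 1) + 2.
    by rewrite floor_lt_int [X in _ < X]rmorphD /=; lra.
  rewrite /O !inE; lia.
pose OO := [seq (a, b) | a <- O, b <- O].
apply: (@le_trans _ _ (\sum_(o <- OO) mass f W n (cell n x + o.1, cell n (f x) + o.2))); last first.
  apply: (@le_trans _ _ (\sum_(o <- OO) D)); first exact: ler_sum.
  by rewrite /OO /O /= !big_cons big_nil; lra.
rewrite /mass; rewrite (eq_bigr _ (fun a _ => big_mkcond _ _)) exchange_big /= big_mkcond /=.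
rewrite !big_seq; apply: ler_sum => v vW.
have [/andP[h1 h2]|_] := boolP (_ && _); last first.
  by apply: sumr_ge0 => o _; case: ifP => // _; exact: W0.
have oO : (cell n v.1 - cell n x, cell n (f v.1) - cell n (f x)) \in OO.
  by apply: allpairs_f; apply: cO.
rewrite (bigD1_seq _ oO)//= !subrKC eqxx lerDl.
by apply: sumr_ge0 => o _; case: ifP => // _; exact: W0.
Qed.

(** * Strips and transversality *)

Lemma count_above {R : realType} (p : pred nat) N (a : R) :
  (forall i, (i < N)%N -> p i -> a <= i%:R) ->
  \sum_(i < N) (p i)%:R <= Num.max 0 (N%:R - a).
Proof.
elim: N => [|N IH] h; first by rewrite big_ord0 le_max lexx.
have {IH} := IH (fun i iN => h i (ltnW iN)).
rewrite big_ord_recr /=; move: (\sum_(_ < _) _) => S.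
rewrite -(natr1 N) !le_max; case: (boolP (p N)) => pN /=.
  have := h N (ltnSn N) pN; move=> h1 /orP[?|?]; apply/orP; right; lra.
by rewrite addr0 => /orP[->//|h1]; apply/orP; right; lra.
Qed.

(** All counted indices lie within [D] of the largest one, and [count_above] applies. *)
Lemma count_diam {R : realType} (p : pred nat) N (D : R) : 0 <= D ->
  (forall i j, (i < N)%N -> (j < N)%N -> p i -> p j -> `|i%:R - j%:R| <= D) ->
  \sum_(i < N) (p i)%:R <= D + 1.
Proof.
move=> D0; elim: N => [|N IH] h; first by rewrite big_ord0; lra.
rewrite big_ord_recr /=; case: (boolP (p N)) => pN /=; last first.
  by rewrite addr0; apply: IH => i j iN jN; apply: h; exact: ltnW.
rewrite lerD2r; have H := @count_above R p N (N%:R - D).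
have: \sum_(i < N) (p i)%:R <= Num.max 0 (N%:R - (N%:R - D)).
  apply: H => i iN pi; have := h N i (ltnSn N) (ltnW iN) pN pi.
  by rewrite ler_norml => /andP[_]; lra.
by rewrite le_max => /orP[]; lra.
Qed.

Lemma sum_geom_tail {R : realType} (q : R) n k : 0 <= q < 1 -> (n <= k)%N ->
  \sum_(n <= j < k) q ^+ j <= q ^+ n / (1 - q).
Proof.
move=> /andP[q0 q1] nk; rewrite ler_pdivlMr ?subr_gt0//.
suff -> : (\sum_(n <= j < k) q ^+ j) * (1 - q) = q ^+ n - q ^+ k.
  by rewrite gerBl exprn_ge0.
move: nk => /subnKC <-; elim: (k - n)%N => [|m IH].
  by rewrite addn0 big_geq// mul0r subrr.
by rewrite addnS big_nat_recr ?leq_addr//= mulrDl IH exprS; ring.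
Qed.

(** The number of the strip of slope [i / 2 ^+ k] and vertical width 2^-k through the point over
    [x]. The shift by [B + 1] keeps the truncated quantity nonnegative on the graph. *)
Definition strip {R : realType} (f : R -> R) (B k i : nat) (x : R) : nat :=
  Num.truncn (2 ^+ k * (f x - i%:R / 2 ^+ k * x + B%:R + 1)).

Section Strips.
Context {R : realType} (f : R -> R) (E : set R) (B : nat).
Hypothesis E01 : forall x, E x -> 0 <= x <= 1.
Hypothesis fB : forall x, E x -> `|f x| <= B%:R.

Lemma slope_itv (i k : nat) : (i < 2 ^ k)%N -> 0 <= (i%:R / 2 ^+ k : R) <= 1.
Proof.
move=> ik; rewrite divr_ge0 ?exprn_ge0//= ler_pdivrMr ?exprn_gt0// mul1r -natrX ler_nat.
exact: ltnW.
Qed.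

Lemma strip_arg (i k : nat) x : (i < 2 ^ k)%N -> E x ->
  0 <= f x - i%:R / 2 ^+ k * x + B%:R + 1 < (B + B).+2%:R.
Proof.
move=> ik Ex; have /andP[x0 x1] := E01 Ex; have := fB Ex; rewrite ler_norml => /andP[f1 f2].
have /andP[m0 m1] := slope_itv ik; rewrite -[(B + B).+2]addn2 !natrD.
move: (_ / _) m0 m1 => m m0 m1.
have h1 : 0 <= m * x by rewrite mulr_ge0.
have h2 : m * x <= 1 by rewrite mulr_ile1.
by apply/andP; split; lra.
Qed.

Lemma strip_itv (i k : nat) x : (i < 2 ^ k)%N -> E x ->
  0 <= f x - i%:R / 2 ^+ k * x - ((strip f B k i x)%:R / 2 ^+ k - B%:R - 1) < 2 ^- k.
Proof.
move=> ik Ex; have p0 : 0 < 2 ^+ k :> R by rewrite exprn_gt0.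
have /andP[h0 _] := strip_arg ik Ex.
have := @truncn_itv R (2 ^+ k * (f x - i%:R / 2 ^+ k * x + B%:R + 1)).
rewrite -/(strip f B k i x) => /(_ (mulr_ge0 (ltW p0) h0)) /andP[a1 a2].
rewrite -[X in _ < X]natr1 in a2.
set S := (strip f B k i x)%:R; rewrite -/S in a1 a2.
have b1 : S / 2 ^+ k <= f x - i%:R / 2 ^+ k * x + B%:R + 1 by rewrite ler_pdivrMr// mulrC.
have b2 : f x - i%:R / 2 ^+ k * x + B%:R + 1 < S / 2 ^+ k + 2 ^- k.
  have -> : S / 2 ^+ k + 2 ^- k = (S + 1) / 2 ^+ k by rewrite mulrDl mul1r.
  by rewrite ltr_pdivlMr// mulrC.
by apply/andP; split; lra.
Qed.

Lemma strip_lt (i k : nat) x : (i < 2 ^ k)%N -> E x -> (strip f B k i x < (B + B).+2 * 2 ^ k)%N.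
Proof.
move=> ik Ex; have p0 : 0 < 2 ^+ k :> R by rewrite exprn_gt0.
have /andP[h0 h1] := strip_arg ik Ex.
by rewrite truncn_lt_nat ?mulr_ge0 ?(ltW p0)// mulnC natrM natrX ltr_pM2l.
Qed.

Lemma strip_eq (i k : nat) x y : (i < 2 ^ k)%N -> E x -> E y ->
  strip f B k i x = strip f B k i y ->
  `|(f y - f x) - i%:R / 2 ^+ k * (y - x)| < 2 ^- k.
Proof.
move=> ik Ex Ey e; have := strip_itv ik Ex; have := strip_itv ik Ey; rewrite e.
move=> /andP[a1 a2] /andP[b1 b2]; rewrite ltr_norml mulrBr; apply/andP; split; lra.
Qed.

Definition close j x y := (`|y - x| <= 2 * 2 ^- j) && (`|f y - f x| <= 2 * 2 ^- j).

(* Transversality: two points at distance about 2^-j lie in a common strip for at most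
   about 2^j of the 2^k slopes. *)
Lemma pair_count n k x y : (n <= k)%N -> E x -> E y -> `|y - x| <= 2 ^- n ->
  \sum_(i < 2 ^ k) (strip f B k i y == strip f B k i x)%:R <=
  \sum_(n <= j < k.+1) 5 * 2 ^+ j * (close j x y)%:R :> R.
Proof.
move=> nk Ex Ey xyn.
have [no|] := boolP [forall i : 'I_(2 ^ k), strip f B k i y != strip f B k i x].
  rewrite big1 => [|i _]; last by rewrite (negbTE (forallP no i)).
  by apply: sumr_ge0 => j _; rewrite !mulr_ge0 ?exprn_ge0.
rewrite negb_forall => /existsP[i0]; rewrite negbK => /eqP e0.
(* The scale [j] is the finest one, up to [k], at which the two points are still within 2^-j
   horizontally. *)
have exP : exists j, (j <= k)%N && (`|y - x| <= 2 ^- j) by exists n; rewrite nk.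
have bd j : (j <= k)%N && (`|y - x| <= 2 ^- j) -> (j <= k)%N by case/andP.
case: (ex_maxnP exP bd) => j /andP[jk xyj] jmax.
have nj : (n <= j)%N by apply: jmax; rewrite nk.
have jk2 : 2 ^- k <= 2 ^- j :> R.
  by rewrite lef_pV2 ?posrE ?exprn_gt0// ler_weXn2l// ler1n.
(* A common strip of slope at most 1 bounds the vertical distance by the horizontal one plus
   2^-k. *)
have cl : close j x y.
  rewrite /close; apply/andP; split; first by have := normr_ge0 (y - x); lra.
  have := strip_eq (ltn_ord i0) Ex Ey (esym e0); have /andP[m0 m1] := slope_itv (ltn_ord i0).
  move: (_ / _) m0 m1 => m m0 m1 h.
  have -> : f y - f x = ((f y - f x) - m * (y - x)) + m * (y - x) by rewrite subrK.
  apply: le_trans (ler_normD _ _) _.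
  have : `|m * (y - x)| <= `|y - x| by rewrite normrM ger0_norm// ler_piMl.
  by lra.
(* For [j = k] all slopes may count. Otherwise the distance exceeds 2^-(j+1), and two common slopes
   satisfy |i - i'| |y - x| < 2, so the indices lie within [4 * 2 ^+ j] of each other. *)
have main : \sum_(i < 2 ^ k) (strip f B k i y == strip f B k i x)%:R <= 5 * 2 ^+ j :> R.
  have p1 : 1 <= 2 ^+ j :> R by rewrite exprn_ege1// ler1n.
  have [jk'|jk'] := eqVneq j k.
    apply: (@le_trans _ _ (\sum_(i < 2 ^ k) 1)).
      by apply: ler_sum => i _; case: (_ == _).
    rewrite sumr_const card_ord jk' natrX ler_peMl ?exprn_ge0//; lra.
  have jk1 : (j < k)%N by rewrite ltn_neqAle jk'.
  have far : 2 ^- j.+1 < `|y - x|.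
    by rewrite ltNge; apply/negP => h; have := jmax j.+1; rewrite jk1 h ltnn => /(_ isT).
  apply: le_trans (_ : 4 * 2 ^+ j + 1 <= _); last by lra.
  apply: (@count_diam R (fun i => strip f B k i y == strip f B k i x)).
    by rewrite mulr_ge0 ?exprn_ge0.
  move=> i i' ik ik' /eqP ei /eqP ei'.
  have := strip_eq ik Ex Ey (esym ei); have := strip_eq ik' Ex Ey (esym ei').
  have p0 : 0 < 2 ^+ k :> R by rewrite exprn_gt0.
  have q0 : 0 < `|y - x| by apply: lt_trans far; rewrite invr_gt0 exprn_gt0.
  move=> h' h.
  have : `|(i%:R / 2 ^+ k - i'%:R / 2 ^+ k) * (y - x)| < 2 * 2 ^- k.
    rewrite mulrBl; move: h h'; rewrite !ltr_norml => /andP[? ?] /andP[? ?].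
    by apply/andP; split; lra.
  rewrite -mulrBl 2!normrM normrV ?unitfE ?gt_eqF// (gtr0_norm p0).
  rewrite mulrAC ltr_pM2r ?invr_gt0// => h2.
  rewrite -(ler_pM2r q0) (le_trans (ltW h2))//.
  have : 4 * 2 ^+ j * 2 ^- j.+1 <= 4 * 2 ^+ j * `|y - x|.
    by rewrite ler_pM2l ?mulr_gt0 ?exprn_gt0// ltW.
  have -> : 4 * 2 ^+ j * 2 ^- j.+1 = 2 :> R by rewrite exprS; field; rewrite expf_neq0.
  by [].
apply: (le_trans main).
rewrite (bigD1_seq j) ?mem_index_iota ?nj ?iota_uniq//= cl mulr1 lerDl.
by apply: sumr_ge0 => l _; rewrite !mulr_ge0 ?exprn_ge0.
Qed.

Definition nu (W : seq (R * R)) k i x n : R :=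
  \sum_(v <- W | (strip f B k i v.1 == strip f B k i x) && (`|v.1 - x| <= 2 ^- n)) v.2.

(** At scale [j] a point shares at most [5 * 2 ^+ j] strips with [x], and the mass near [x] is at
    most [25 * th ^+ j]. The products form a geometric series starting at [j = n]. *)
Lemma sum_nu (th : R) (W : seq (R * R)) k n x : 0 <= th -> 2 * th < 1 ->
  (forall v, v \in W -> E v.1 /\ 0 <= v.2) ->
  (forall n a, (n <= k)%N -> mass f W n a <= th ^+ n) -> (n <= k)%N -> E x ->
  \sum_(i < 2 ^ k) nu W k i x n <= 125 / (1 - 2 * th) * (2 * th) ^+ n.
Proof.
move=> th0 th1 WE Wm nk Ex; rewrite /nu.
rewrite (eq_bigr _ (fun i _ => big_mkcond _ _)) exchange_big /=.
apply: (@le_trans _ _ (\sum_(v <- W) \sum_(n <= j < k.+1) (5 * 2 ^+ j * (close j x v.1)%:R) * v.2)).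
  rewrite !big_seq; apply: ler_sum => v vW; have [Ev v0] := WE _ vW.
  have [h|h] := boolP (`|v.1 - x| <= 2 ^- n); last first.
    rewrite big1 => [|i _]; last by rewrite andbF.
    by apply: sumr_ge0 => j _; rewrite !mulr_ge0 ?exprn_ge0.
  apply: (@le_trans _ _ (\sum_(i < 2 ^ k) (strip f B k i v.1 == strip f B k i x)%:R * v.2)).
    by apply: ler_sum => i _; rewrite andbT; case: ifP; rewrite ?mul1r ?mul0r.
  by rewrite -!mulr_suml ler_wpM2r// pair_count.
rewrite exchange_big /=.
apply: (@le_trans _ _ (\sum_(n <= j < k.+1) 125 * (2 * th) ^+ j)).
  rewrite big_nat_cond [leRHS]big_nat_cond; apply: ler_sum => j; rewrite andbT => /andP[nj jk].
  have -> : \sum_(v <- W) 5 * 2 ^+ j * (close j x v.1)%:R * v.2 =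
      5 * 2 ^+ j * \sum_(v <- W | close j x v.1) v.2.
    rewrite mulr_sumr [RHS]big_mkcond /=; apply: eq_bigr => v _.
    by case: (close _ _ _); rewrite ?mulr1 // mulr0 mul0r.
  have := @mass_ball R f W j x (th ^+ j) (fun v vW => (WE v vW).2) (fun a => Wm j a jk).
  rewrite -/(close j x _) exprMn => h.
  have -> : 125 * (2 ^+ j * th ^+ j) = 5 * 2 ^+ j * (25 * th ^+ j) by ring.
  by rewrite ler_wpM2l// mulr_ge0// exprn_ge0.
rewrite -mulr_sumr -mulrA ler_pM2l// [leRHS]mulrC; apply: sum_geom_tail; last exact: leqW.
by rewrite mulr_ge0.
Qed.

(** A Frostman condition along the strip at all levels up to [k]; the division by [2 ^+ k] accounts
    for the share of the whole mass that one strip typically carries. *)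
Definition good (W : seq (R * R)) (M lam : R) k i x : bool :=
  [forall n : 'I_k.+1, nu W k i x n <= M * lam ^+ n / 2 ^+ k].

(** Markov's inequality at each level [n], summed over [n]. The ratios form a geometric series of
    ratio [2 * th / lam], and [M] is chosen so that at most half of the slopes are bad. *)
Lemma good_count (th lam M : R) (W : seq (R * R)) k x : 0 <= th -> 2 * th < 1 -> 0 < lam ->
  2 * th < lam ->
  (forall v, v \in W -> E v.1 /\ 0 <= v.2) ->
  (forall n a, (n <= k)%N -> mass f W n a <= th ^+ n) -> E x ->
  M = 2 * (125 / (1 - 2 * th)) / (1 - 2 * th / lam) ->
  2 ^+ k / 2 <= \sum_(i < 2 ^ k) (good W M lam k i x)%:R :> R.
Proof.
move=> th0 th1 lam0 thl WE Wm Ex ME.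
have p0 : 0 < 2 ^+ k :> R by rewrite exprn_gt0.
have [K KE] : {K | K = 125 / (1 - 2 * th)} by exists (125 / (1 - 2 * th)).
have K0 : 0 < K by rewrite KE divr_gt0//; lra.
have q1 : 2 * th / lam < 1 by rewrite ltr_pdivrMr// mul1r.
have M0 : 0 < M by rewrite ME -KE divr_gt0 ?mulr_gt0 ?subr_gt0.
have nu0 i n : 0 <= nu W k i x n.
  by rewrite /nu big_seq_cond; apply: sumr_ge0 => v /andP[/WE[]].
have bad i : (1 : R) - (good W M lam k i x)%:R <=
    \sum_(n < k.+1) nu W k i x n / (M * lam ^+ n / 2 ^+ k).
  have d0 n : 0 < M * lam ^+ n / 2 ^+ k by rewrite divr_gt0// mulr_gt0// exprn_gt0.
  have t0 n : 0 <= nu W k i x n / (M * lam ^+ n / 2 ^+ k) by rewrite divr_ge0// ltW.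
  have [_|] := boolP (good _ _ _ _ _ _); first by rewrite subrr sumr_ge0.
  rewrite negb_forall => /existsP[n]; rewrite -ltNge => h.
  rewrite subr0 (bigD1 n)//= -[leLHS]addr0 lerD ?sumr_ge0//.
  by rewrite ler_pdivlMr// mul1r ltW.
have : \sum_(i < 2 ^ k) ((1 : R) - (good W M lam k i x)%:R) <= 2 ^+ k / 2.
  apply: (@le_trans _ _ (\sum_(i < 2 ^ k) \sum_(n < k.+1) nu W k i x n / (M * lam ^+ n / 2 ^+ k))).
    by apply: ler_sum => i _; exact: bad.
  rewrite exchange_big /=.
  apply: (@le_trans _ _ (\sum_(n < k.+1) 2 ^+ k * K / M * (2 * th / lam) ^+ n)).
    apply: ler_sum => n _; rewrite -mulr_suml.
    have h := sum_nu th0 th1 WE Wm (ltn_ord n : (n <= k)%N) Ex; rewrite -KE in h.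
    have -> : 2 ^+ k * K / M * (2 * th / lam) ^+ n = K * (2 * th) ^+ n / (M * lam ^+ n / 2 ^+ k).
      by rewrite exprMn exprVn; field; rewrite !gt_eqF ?exprn_gt0.
    by rewrite ler_pM2r// invr_gt0 divr_gt0// mulr_gt0// exprn_gt0.
  rewrite -mulr_sumr -(big_mkord xpredT (fun n => (2 * th / lam) ^+ n)).
  have := @sum_geom_tail R (2 * th / lam) 0 k.+1.
  rewrite q1 divr_ge0 ?mulr_ge0 ?(ltW lam0)// => /(_ isT isT) h.
  have c0 : 0 <= 2 ^+ k * K / M by rewrite divr_ge0 ?mulr_ge0// ltW.
  apply: le_trans (ler_wpM2l c0 h) _.
  rewrite ME -KE expr0 le_eqVlt; apply/orP; left; apply/eqP; field.
  by rewrite !gt_eqF//; lra.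
rewrite sumrB sumr_const card_ord natrX.
by lra.
Qed.

End Strips.

(** * A good strip at each scale *)

(** For slopes in [0,1], a necessary condition for the line y = m x + b to meet the box of center
    [w.1.1] and radius [w.1.2]; the entry [w.2] is a weight given to the box. *)
Definition line_met {R : realType} (m b : R) (w : (R * R) * R * R) : bool :=
  `|w.1.1.2 - m * w.1.1.1 - b| < 2 * w.1.2.

(** The intercepts fill an interval of length [4 * w.1.2] with step 2^-k; the extra unit is absorbed
    as the radius is at least one step. *)
Lemma lines_met_count {R : realType} (B k N : nat) (m : R) (w : (R * R) * R * R) :
  2 ^- k <= w.1.2 ->
  \sum_(j < N) (line_met m (j%:R / 2 ^+ k - B%:R - 1) w)%:R <= 5 * w.1.2 * 2 ^+ k :> R.
Proof.
move=> rk; have p0 : 0 < 2 ^+ k :> R by rewrite exprn_gt0.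
have rp : 1 <= w.1.2 * 2 ^+ k.
  by rewrite -ler_pdivrMr// mul1r.
apply: (@le_trans _ _ (4 * w.1.2 * 2 ^+ k + 1)); last by lra.
apply: (@count_diam R (fun j => line_met m (j%:R / 2 ^+ k - B%:R - 1) w)); first by lra.
move=> i j _ _; rewrite /line_met; set y := _ - m * _ => hi hj.
rewrite -ler_pdivrMr// -(gtr0_norm p0) -normf_div mulrBl.
move: hi hj; rewrite !ltr_norml => /andP[? ?] /andP[? ?].
rewrite ler_norml; apply/andP; split; lra.
Qed.

Lemma dyadic_scale {R : realType} (r : R) : 0 < r <= 1 ->
  exists n, 2 ^- n.+1 < r <= 2 ^- n.
Proof.
move=> /andP[r0 r1].
have ex : exists n, 2 ^- n.+1 < r.
  have [n hn] : exists n, r^-1 < n%:R by exists (Num.truncn r^-1).+1; exact: truncnS_gt.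
  exists n; rewrite invf_plt ?posrE ?exprn_gt0//; apply: (lt_trans hn).
  by rewrite -natrX ltr_nat (ltn_trans (ltnSn n))// ltn_expl.
case: (ex_minnP ex) => -[|n] h1 h2.
  by exists 0%N; rewrite h1 expr0 invr1.
exists n.+1; rewrite h1 /= leNgt; apply/negP => h3.
by have := h2 n h3; rewrite ltnn.
Qed.

(** First moment over all slopes and intercepts: the rescaled good mass of a strip, minus the weight
    of the boxes its line may meet, minus a constant has positive sum. Hence one strip has both a
    large mass and a small weight of boxes. *)
Lemma discrete_slice {R : realType} (f : R -> R) (E : set R) (B : nat) (t u : R) :
  (forall x, E x -> 0 <= x <= 1) -> (forall x, E x -> `|f x| <= B%:R) ->
  0 < u -> u + 1 < t -> ~ null box2 t (graph f E) ->
  exists eta M c : R, [/\ 0 < eta, 0 < M, 0 < c &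
    forall k (H : seq ((R * R) * R * R)),
      (forall w, w \in H -> 2 ^- k <= w.1.2 /\ 0 <= w.2) ->
      \sum_(w <- H) w.2 * w.1.2 <= eta ->
    exists (m b : R) (V : seq (R * R)),
      [/\ 0 <= m <= 1 /\ `|b| <= B%:R + 1,
          forall v, v \in V -> [/\ E v.1, 0 <= v.2 & `|f v.1 - m * v.1 - b| <= 2 ^- k],
          c <= \sum_(v <- V) v.2,
          forall z r, 2 ^- k <= r -> \sum_(v <- V | `|v.1 - z| < r) v.2 <= M * powR (4 * r) u
        & \sum_(w <- H | line_met m b w) w.2 <= M]].
Proof.
move=> E01 fB u0 ut nE.
have t0 : 0 < t by lra.
have EB x : E x -> `|x| <= B.+1%:R /\ `|f x| <= B.+1%:R.
  move=> Ex; have /andP[x0 x1] := E01 _ Ex; have := fB _ Ex; rewrite -[B.+1%:R]natr1 [`|x|]ger0_norm//.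
  by move=> h1; have h0 : 0 <= B%:R :> R := ler0n _ _; split; lra.
have [c c0 hW] := frostman t0 EB nE.
pose th : R := powR 2 (- t); pose lam : R := powR 2 (- u).
have th0 : 0 < th by rewrite powR_gt0.
have lam0 : 0 < lam by rewrite powR_gt0.
have two : 2 * th = powR 2 (1 - t).
  by rewrite /th powRD ?powRr1//; apply/implyP.
(* With this monotonicity, [2 * th < lam] expresses [u + 1 < t]: slicing loses one dimension. *)
have ltp (a b : R) : a < b -> powR 2 a < powR 2 b :> R.
  by move=> ab; rewrite /powR gt_eqF// ltr_expR ltr_pM2r// ln_gt0// ltr1n.
have thl : 2 * th < lam by rewrite two; apply: ltp; lra.
have lam1 : lam < 1 by rewrite -(powRr0 2); apply: ltp; lra.
have th1 : 2 * th < 1 by exact: lt_trans lam1.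
have [M ME] : {M | M = 2 * (125 / (1 - 2 * th)) / (1 - 2 * th / lam)} by eexists.
have M0 : 0 < M.
  have q1 : 2 * th / lam < 1 by rewrite ltr_pdivrMr// mul1r.
  by rewrite ME !(divr_gt0, mulr_gt0)// subr_gt0.
have B0 : 0 < B%:R + 1 :> R by rewrite natr1 ltr0n.
(* In units of 4^k, the good mass gives at least c/2, the boxes cost at most 5 c/20 = c/4, and the
   constant, over [2 * (B + 1)] units of strips, costs c/8. *)
exists (c / 20), M, (c / (16 * (B%:R + 1))); split => //; rewrite ?divr_gt0 ?mulr_gt0//.
move=> k H Hr Hs; have p0 : 0 < 2 ^+ k :> R by rewrite exprn_gt0.
have [W [WE Wm Wc]] := hW k.
pose N := ((B + B).+2 * 2 ^ k)%N.
have NE : N%:R = 2 * (B%:R + 1) * 2 ^+ k :> R.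
  rewrite /N natrM natrX -[(B + B).+2]addn2 !natrD; ring.
pose gd i x := good f B W M lam k i x.
pose gm i j := \sum_(v <- W | (strip f B k i v.1 == j) && gd i v.1) v.2.
pose mm (i : nat) : R := i%:R / 2 ^+ k.
pose bb (j : nat) : R := j%:R / 2 ^+ k - B%:R - 1.
pose ct i j := \sum_(w <- H | line_met (mm i) (bb j) w) w.2.
set c2 := c / (16 * _).
have [i [j hij]] : exists (i : 'I_(2 ^ k)) (j : 'I_N), 0 <= 2 ^+ k * gm i j - ct i j - c2.
  apply: contrapT => no.
  have : \sum_(i < 2 ^ k) \sum_(j < N) (2 ^+ k * gm i j - ct i j - c2) <= 0.
    apply: sumr_le0 => i _; apply: sumr_le0 => j _; rewrite leNgt; apply/negP => h.
    by apply: no; exists i, j; exact: ltW.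
  have G : 2 ^+ k / 2 * c <= \sum_(i < 2 ^ k) \sum_(j < N) gm i j.
    rewrite (eq_bigr (fun i : 'I_(2 ^ k) => \sum_(v <- W) (gd i v.1)%:R * v.2)); last first.
      move=> i _; rewrite /gm (eq_bigr _ (fun j _ => big_mkcond _ _)) exchange_big /=.
      rewrite !big_seq; apply: eq_bigr => v vW; have [Ev _] := WE _ vW.
      have sN := strip_lt E01 fB (ltn_ord i) Ev.
      rewrite (bigD1 (Ordinal sN))//= eqxx /= big1 ?addr0 => [|j].
        by case: (gd _ _); rewrite ?mul1r ?mul0r.
      by rewrite -val_eqE /= eq_sym => /negbTE ->.
    rewrite exchange_big /=; apply: (@le_trans _ _ (\sum_(v <- W) 2 ^+ k / 2 * v.2)).
      by rewrite -mulr_sumr ler_wpM2l// divr_ge0// ltW.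
    rewrite !big_seq; apply: ler_sum => v vW; have [Ev v0] := WE _ vW.
    rewrite -mulr_suml ler_wpM2r//.
    exact: (good_count E01 fB (ltW th0) th1 lam0 thl WE Wm Ev ME).
  have C : \sum_(i < 2 ^ k) \sum_(j < N) ct i j <= 2 ^+ k * (2 ^+ k * (5 * (c / 20))).
    apply: (@le_trans _ _ (\sum_(i < 2 ^ k) 2 ^+ k * (5 * (c / 20)))); last first.
      by rewrite sumr_const card_ord -[leLHS]mulr_natl natrX.
    apply: ler_sum => i _.
    rewrite /ct (eq_bigr _ (fun j _ => big_mkcond _ _)) exchange_big /=.
    apply: (@le_trans _ _ (\sum_(w <- H) 2 ^+ k * 5 * (w.2 * w.1.2))); last first.
      by rewrite -mulr_sumr -!mulrA !ler_pM2l.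
    rewrite !big_seq; apply: ler_sum => w wH; have [rw hw] := Hr _ wH.
    have h := @lines_met_count R B k N (mm i) w rw.
    have -> : 2 ^+ k * 5 * (w.2 * w.1.2) = 5 * w.1.2 * 2 ^+ k * w.2 by ring.
    apply: le_trans (ler_wpM2r hw h); rewrite mulr_suml; apply: ler_sum => j _.
    by rewrite /bb; case: ifP; rewrite ?mul1r ?mul0r.
  have -> : \sum_(i < 2 ^ k) \sum_(j < N) (2 ^+ k * gm i j - ct i j - c2) =
     2 ^+ k * (\sum_(i < 2 ^ k) \sum_(j < N) gm i j) - (\sum_(i < 2 ^ k) \sum_(j < N) ct i j)
     - 2 ^+ k * (N%:R * c2).
    under eq_bigr do rewrite !sumrB -mulr_sumr sumr_const card_ord -[c2 *+ N]mulr_natl.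
    by rewrite !sumrB -mulr_sumr sumr_const card_ord -[(_ * c2) *+ _]mulr_natl natrX.
  have -> : 2 ^+ k * (N%:R * c2) = 2 ^+ k * 2 ^+ k * c / 8 :> R.
    by rewrite NE /c2; field; rewrite gt_eqF.
  have := ler_wpM2l (ltW p0) G.
  have : 0 < 2 ^+ k * 2 ^+ k * c by rewrite !mulr_gt0.
  by move: C; move: (\sum_(_ < _) _) (\sum_(_ < _) _) (2 ^+ k) => S1 S2 K; lra.
have ct0 : 0 <= ct i j.
  by rewrite /ct big_seq_cond; apply: sumr_ge0 => w /andP[/Hr[]].
have c20 : 0 < c2 by rewrite divr_gt0// mulr_gt0.
(* The good points of the chosen strip, with weights scaled by [2 ^+ k] so that the mass stays
   bounded below as [k] grows. *)
pose V := [seq (v.1, 2 ^+ k * v.2) | v <- W & (strip f B k i v.1 == j) && gd i v.1].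
have VE v : v \in V -> [/\ E v.1, 0 <= v.2, strip f B k i v.1 == j & gd i v.1].
  move=> /mapP[w]; rewrite mem_filter => /andP[/andP[h1 h2] /WE[Ew w0]] -> /=.
  by split => //; rewrite mulr_ge0// ltW.
have sV (P : pred R) : \sum_(v <- V | P v.1) v.2 =
    2 ^+ k * \sum_(v <- W | [&& strip f B k i v.1 == j, gd i v.1 & P v.1]) v.2.
  rewrite big_map /= big_filter_cond mulr_sumr; apply: eq_bigl => v.
  by rewrite -andbA.
have sVT : \sum_(v <- V) v.2 = 2 ^+ k * gm i j.
  by rewrite /V big_map /= big_filter mulr_sumr.
have ball n x : (n <= k)%N -> x \in [seq v.1 | v <- V] ->
    \sum_(v <- V | `|v.1 - x| <= 2 ^- n) v.2 <= M * lam ^+ n.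
  move=> nk /mapP[v0 /VE[Ev _ /eqP sj /forallP g] ->].
  have nk' : (n < k.+1)%N by rewrite ltnS.
  have := g (Ordinal nk'); rewrite /= ler_pdivlMr// => h.
  rewrite (sV (fun y => `|y - v0.1| <= 2 ^- n)) mulrC (le_trans _ h)// ler_pM2r//.
  rewrite /nu sj big_mkcond [leRHS]big_mkcond /= !big_seq; apply: ler_sum => v /WE[_ v0'].
  by case: (_ == _) => //=; case: (gd _ _) => //=; case: ifP.
have small x : x \in [seq v.1 | v <- V] -> \sum_(v <- V) v.2 <= M.
  move=> xV; have := ball 0%N x isT xV; rewrite !expr0 invr1 mulr1; apply: le_trans.
  rewrite [leRHS]big_mkcond /= !big_seq; apply: ler_sum => v vV; have [Ev v0 _ _] := VE _ vV.
  move/mapP: xV => [w /VE[Ew _ _ _] ->].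
  have /andP[? ?] := E01 _ Ev; have /andP[? ?] := E01 _ Ew.
  suff -> : `|v.1 - w.1| <= 1 by [].
  by rewrite ler_norml; apply/andP; split; lra.
have V0 (P : pred R) : \sum_(v <- V | P v.1) v.2 <= \sum_(v <- V) v.2.
  rewrite big_mkcond /= !big_seq; apply: ler_sum => v /VE[_ v0 _ _]; by case: ifP.
exists (mm i), (bb j), V; split.
- split; first exact: slope_itv.
  have jN : j%:R / 2 ^+ k < 2 * (B%:R + 1) :> R by rewrite ltr_pdivrMr// -NE ltr_nat.
  have : 0 <= j%:R / 2 ^+ k :> R by rewrite divr_ge0// ltW.
  by rewrite /bb ler_norml => h; apply/andP; split; lra.
- move=> v /VE[Ev v0 /eqP sj _]; split => //.
  have /andP[h1 h2] := strip_itv E01 fB (ltn_ord i) Ev.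
  by rewrite sj in h1 h2; rewrite /bb ger0_norm// ltW.
- by rewrite sVT; lra.
(* A ball around any [z] that contains a point [x] of [V] lies in the ball of radius [2 * r] around
   [x]; rounding up to a dyadic radius gives at most [4 * r]. *)
- move=> z r rk; have r0 : 0 < r by apply: lt_le_trans rk; rewrite invr_gt0.
  have [/hasP[x xV xz]|no] := boolP (has (fun x => `|x - z| < r) [seq v.1 | v <- V]); last first.
    rewrite big1_seq ?mulr_ge0 ?powR_ge0 ?(ltW M0)// => v /andP[h vV].
    by case/hasP: no; exists v.1 => //; exact: map_f.
  have [r1|r1] := leP 1 (2 * r).
    apply: le_trans (V0 (fun y => `|y - z| < r)) _; apply: le_trans (small _ xV) _.
    rewrite ler_pMr//; have := @powR_mono R u 1 (4 * r); rewrite powR1; apply; lra.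
  have [|n /andP[n1 n2]] := @dyadic_scale R (2 * r); first by apply/andP; split; lra.
  have nk : (n <= k)%N.
    rewrite leqNgt; apply/negP => kn.
    have : 2 ^- n <= 2 ^- k :> R.
      by rewrite lef_pV2 ?posrE ?exprn_gt0// ler_weXn2l ?ler1n// ltnW.
    by lra.
  apply: (@le_trans _ _ (M * lam ^+ n)).
    apply: le_trans (ball n x nk xV); rewrite big_mkcond [leRHS]big_mkcond /= !big_seq.
    apply: ler_sum => v /VE[_ v0 _ _]; case: ifP => [h|_]; last by case: ifP.
    suff -> : `|v.1 - x| <= 2 ^- n by [].
    move: h xz; rewrite !ltr_norml => /andP[? ?] /andP[? ?].
    by rewrite ler_norml; apply/andP; split; lra.
  rewrite ler_pM2l// -powR2_expn; apply: powR_mono; rewrite ?invr_ge0 ?exprn_ge0//; first exact: ltW.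
  have : 2 ^- n.+1 = 2 ^- n / 2 :> R by rewrite exprS invfM mulrC.
  by lra.
(* The weight of the boxes is at most the mass of [V], and that mass is at most [M] by the estimate
   at level 0. *)
- have [x xV] : exists x, x \in [seq v.1 | v <- V].
    have [V_nil|] := eqVneq V [::]; last first.
      by case: V {VE sV sVT ball small V0} => [//|v V _]; exists v.1; rewrite mem_head.
    by have : \sum_(v <- V) v.2 = 0; [rewrite V_nil big_nil|rewrite sVT => h; move: hij; rewrite h; lra].
  by have := small x xV; rewrite sVT -/(ct i j); lra.
Qed.

(** * Slices by lines *)

(* [ler_normD] and [ler_normB] restated at [realType]: [lra] does not identify their norms
   with the ones elaborated in the statements below. *)
Lemma real_normD {R : realType} (x y : R) : `|x + y| <= `|x| + `|y|.
Proof. exact: ler_normD. Qed.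

Lemma real_normB {R : realType} (x y : R) : `|x - y| <= `|x| + `|y|.
Proof. exact: ler_normB. Qed.

(** The subsequence carries the explicit rate 1/(j+1), so limits can be handled by choosing a single
    large index. *)
Definition seq_compact {R : realType} (E : set R) := forall x : nat -> R, (forall n, E (x n)) ->
  exists2 y, E y & exists2 phi : nat -> nat, forall j, (j <= phi j)%N &
    forall j, `|x (phi j) - y| < j.+1%:R^-1.

Definition eps_continuous {R : realType} (E : set R) (f : R -> R) :=
  forall x, E x -> forall e, 0 < e ->
    exists2 d, 0 < d & forall y, E y -> `|y - x| < d -> `|f y - f x| < e.

Lemma compact_seq_compact {R : realType} (E : set R) : compact E -> seq_compact E.
Proof.
move=> cE x xE.
have [|y [Ey cly]] := cE (x @ \oo) _; first by exists 0%N => // n _; exact: xE.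
exists y => //.
have /choice[phi h] : forall j : nat, exists n : nat, (j <= n)%N /\ `|x n - y| < j.+1%:R^-1.
  move=> j.
  have [z [[n /= jn <-] bz]] : ([set x n | n in [set n | (j <= n)%N]] `&` ball y j.+1%:R^-1) !=set0.
    apply: cly; first by exists j => // n jn; exists n.
    by apply: nbhsx_ballx; rewrite invr_gt0.
  by exists n; split => //; rewrite distrC.
by exists phi => j; have [] := h j.
Qed.

Lemma within_eps_continuous {R : realType} (E : set R) (f : R -> R) :
  {within E, continuous f} -> eps_continuous E f.
Proof.
move=> /subspace_continuousP cf x Ex e e0.
have /cvgrPdist_lt/(_ e e0) := cf x Ex.
rewrite near_withinE => /nbhs_ballP[d /= d0 h]; exists d => // y Ey yx.
by rewrite distrC; apply: h => //; rewrite /ball /= distrC.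
Qed.

Lemma invS_small {R : realType} (e : R) : 0 < e ->
  exists J, forall j, (J <= j)%N -> j.+1%:R^-1 < e.
Proof.
move=> e0; exists (Num.truncn e^-1).+1 => j hj.
rewrite invf_plt ?posrE//; apply: (lt_le_trans (truncnS_gt _)).
by rewrite ler_nat (leq_trans hj).
Qed.

Lemma pow2_invS {R : realType} j : 2 ^- j <= j.+1%:R^-1 :> R.
Proof. by rewrite lef_pV2 ?posrE ?exprn_gt0// -natrX ler_nat ltn_expl. Qed.

Lemma pow2_small {R : realType} (e : R) : 0 < e ->
  exists J, forall j, (J <= j)%N -> 2 ^- j <= e.
Proof.
move=> /invS_small[J h]; exists J => j /h he; exact: le_trans (pow2_invS j) (ltW he).
Qed.

Lemma eventually_list {T : eqType} (L : seq T) (P : nat -> T -> Prop) :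
  (forall w, w \in L -> exists J, forall j, (J <= j)%N -> P j w) ->
  exists J, forall j, (J <= j)%N -> forall w, w \in L -> P j w.
Proof.
elim: L => [|a L IH] h; first by exists 0%N.
have [|J1 h1] := IH; first by move=> w wL; apply: h; rewrite inE wL orbT.
have [|J2 h2] := h a; first exact: mem_head.
exists (maxn J1 J2) => j; rewrite geq_max => /andP[j1 j2] w.
by rewrite inE => /predU1P[->|wL]; [exact: h2|exact: h1].
Qed.

Lemma eps_continuous_bounded {R : realType} (E : set R) (f : R -> R) :
  seq_compact E -> eps_continuous E f -> exists B : nat, forall x, E x -> `|f x| <= B%:R.
Proof.
move=> cE cf; apply: contrapT => no.
have /choice[x hx] : forall n : nat, exists x, E x /\ n%:R < `|f x|.
  move=> n; apply: contrapT => h; apply: no; exists n => x Ex.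
  by rewrite leNgt; apply/negP => h'; apply: h; exists x.
have [y Ey [phi p1 p2]] := cE x (fun n => (hx n).1).
have [d d0 hd] := cf y Ey 1 ltr01.
have [J hJ] := invS_small d0.
pose j := maxn J (Num.truncn (`|f y| + 1)).+1.
have := hd _ (hx (phi j)).1 (lt_trans (p2 j) (hJ j (leq_maxl _ _))).
have := (hx (phi j)).2.
have : `|f y| + 1 < (Num.truncn (`|f y| + 1)).+1%:R by exact: truncnS_gt.
have h3 : (Num.truncn (`|f y| + 1)).+1%:R <= (phi j)%:R :> R.
  by rewrite ler_nat (leq_trans _ (p1 j))// leq_maxr.
have := real_normD (f (x (phi j)) - f y) (f y); rewrite subrK.
move: h3; move: ((Num.truncn (`|f y| + 1)).+1%:R : R) => T; lra.
Qed.

(** Points escaping the first [N] boxes for every [N] would accumulate at a point of the graph lying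
    inside some open box. *)
Lemma null_graph_finite_cover {R : realType} (E : set R) (f : R -> R) (t c : R) :
  seq_compact E -> eps_continuous E f -> null box2 t (graph f E) -> 0 < c ->
  exists L : seq ((R * R) * R), [/\ forall u, u \in L -> 0 < u.2,
    forall x, E x -> exists2 u, u \in L & box2 u.1 u.2 (x, f x)
    & \sum_(u <- L) powR u.2 t <= c].
Proof.
move=> cE cf nG c0; have [p [r [r0 cov Sr]]] := nG c c0.
have [N hN] : exists N : nat, forall x, E x -> exists2 n, (n < N)%N & box2 (p n) (r n) (x, f x).
  apply: contrapT => no.
  have /choice[x hx] : forall N : nat, exists x, E x /\
      forall n, (n < N)%N -> ~ box2 (p n) (r n) (x, f x).
    move=> N; apply: contrapT => h; apply: no; exists N => x Ex.
    apply: contrapT => h'; apply: h; exists x; split => // n nN bx.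
    by apply: h'; exists n.
  have [y Ey [phi p1 p2]] := cE x (fun n => (hx n).1).
  have [|n _ [/= b1 b2]] := cov (y, f y); first by exists y.
  have [d d0 hd] := cf y Ey (r n - `|f y - (p n).2|) ltac:(by rewrite subr_gt0).
  have [J1 hJ1] := invS_small d0.
  have [|J2 hJ2] := @invS_small R (r n - `|y - (p n).1|); first by rewrite subr_gt0.
  pose j := maxn n.+1 (maxn J1 J2).
  have j1 : (J1 <= j)%N by rewrite /j; lia.
  have j2 : (J2 <= j)%N by rewrite /j; lia.
  have nj : (n < phi j)%N by apply: leq_trans (p1 j); rewrite /j; lia.
  have [Ex /(_ n nj)] := hx (phi j); apply; split => /=.
    have := lt_trans (p2 j) (hJ2 j j2); have := real_normD (x (phi j) - y) (y - (p n).1).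
    by rewrite addrA subrK; lra.
  have := hd _ Ex (lt_trans (p2 j) (hJ1 _ j1)).
  have := real_normD (f (x (phi j)) - f y) (f y - (p n).2).
  by rewrite addrA subrK; lra.
(* Boxes of radius 0 are empty; without them all radii are positive and exceed 2^-k for large
   [k]. *)
exists [seq (p n, r n) | n <- iota 0 N & 0 < r n]; split.
- by move=> u /mapP[n]; rewrite mem_filter => /andP[rn _] ->.
- move=> x /hN[n nN bx]; exists (p n, r n) => //; apply: map_f.
  rewrite mem_filter mem_iota nN andbT; case: bx => /= h _.
  by rewrite (le_lt_trans (normr_ge0 _) h).
- rewrite big_map big_filter /=; apply: le_trans (Sr N).
  rewrite -(big_mkord xpredT (fun n => powR (r n) t)) /index_iota subn0.
  by rewrite big_mkcond /=; apply: ler_sum => n _; case: ifP => // _; rewrite powR_ge0.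
Qed.

(* One line per stage [J], with the scale [k >= J] of [discrete_slice] eliminated; the cost of
   [discrete_slice] is spent on keeping finite covers of the slices cheap at exponents
   decreasing to [s - 1]. *)
Lemma slice_stages {R : realType} (E : set R) (f : R -> R) (B : nat) (s t u : R) :
  seq_compact E -> eps_continuous E f ->
  (forall x, E x -> 0 <= x <= 1) -> (forall x, E x -> `|f x| <= B%:R) ->
  1 < s -> 0 < u -> u + 1 < t -> ~ null box2 t (graph f E) ->
  (forall s', s < s' -> null box2 s' (graph f E)) ->
  exists (M c : R) (L : nat -> seq ((R * R) * R)), [/\ 0 < M, 0 < c,
    forall q x, E x -> exists2 w, w \in L q & box2 w.1 w.2 (x, f x),
    forall q w, w \in L q -> 0 < w.2
    & forall J : nat, exists (m b : R) (V : seq (R * R)),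
      [/\ 0 <= m <= 1 /\ `|b| <= B%:R + 1,
          forall v, v \in V -> [/\ E v.1, 0 <= v.2 & `|f v.1 - m * v.1 - b| <= 2 ^- J],
          c <= \sum_(v <- V) v.2,
          forall z r, 2 ^- J <= r -> \sum_(v <- V | `|v.1 - z| < r) v.2 <= M * powR (4 * r) u
        & forall q, (q < J)%N -> \sum_(w <- L q | line_met m b (w, 0))
            powR w.2 (s - 1 + q.+1%:R^-1) <= M / q.+1%:R]].
Proof.
move=> cE cf E01 fB s1 u0 ut nt ns.
have [eta [M [c [eta0 M0 c0 main]]]] := discrete_slice E01 fB u0 ut nt.
have q0 (q : nat) : 0 < q.+1%:R^-1 :> R by rewrite invr_gt0.
have /choice[L hL] : forall q : nat, exists L : seq ((R * R) * R),
    [/\ forall u, u \in L -> 0 < u.2,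
    forall x, E x -> exists2 u, u \in L & box2 u.1 u.2 (x, f x)
    & \sum_(u <- L) powR u.2 (s + q.+1%:R^-1) <= eta / 2 ^+ q.+1 / q.+1%:R].
  move=> q; apply: null_graph_finite_cover => //; last by rewrite !divr_gt0// exprn_gt0.
  by apply: ns; rewrite ltrDl.
exists M, c, L; split => //; [by move=> q; have [] := hL q|by move=> q; have [] := hL q|].
move=> J.
(* Times the radius, this weight is [q.+1] times a power of exponent [s + q.+1%:R^-1], and these sum
   to at most [eta / 2 ^+ q.+1]. The factor [q.+1] turns the bound [M] on the strip into
   [M / q.+1]. *)
pose H q := [seq (w, q.+1%:R * powR w.2 (s - 1 + q.+1%:R^-1)) | w <- L q].
pose HH := flatten [seq H q | q <- iota 0 J].
have HHP w : w \in HH -> exists q, w \in H q by move=> /flatten_mapP[q _ wq]; exists q.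
have Hpos w : w \in HH -> 0 < w.1.2 /\ 0 <= w.2.
  move=> /HHP[q /mapP[v vL ->]] /=; have [h _ _] := hL q.
  by rewrite h// mulr_ge0 ?powR_ge0.
have [k0 hk0] : exists k0, forall k, (k0 <= k)%N -> forall w, w \in HH -> 2 ^- k <= w.1.2.
  by apply: eventually_list => w /Hpos[w0 _]; exact: pow2_small.
pose k := maxn k0 J.
have Jk : 2 ^- k <= 2 ^- J :> R.
  by rewrite lef_pV2 ?posrE ?exprn_gt0// ler_weXn2l ?ler1n// leq_maxr.
have [||m [b [V [h1 h2 h3 h4 h5]]]] := main k HH.
- by move=> w wH; split; [apply: hk0 => //; exact: leq_maxl|have [] := Hpos _ wH].
- rewrite big_flatten big_map /=.
  apply: le_trans (sum_geom_half J (ltW eta0)).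
  rewrite -(big_mkord xpredT (fun n => eta / 2 ^+ n.+1)) /index_iota subn0.
  apply: ler_sum => q _; rewrite /H big_map /=; have [Lp _ h] := hL q.
  rewrite (eq_big_seq (fun w => q.+1%:R * powR w.2 (s + q.+1%:R^-1))).
    by rewrite -mulr_sumr mulrC -ler_pdivlMr.
  move=> w wL /=; rewrite -mulrA; congr (_ * _).
  rewrite -[X in _ * X]powRr1 ?(ltW (Lp _ wL))// -powRD; last first.
    by rewrite (gt_eqF (Lp _ wL)) implybT.
  by congr powR; ring.
exists m, b, V; split => //.
- by move=> v /h2[Ev v0 h]; split => //; exact: le_trans Jk.
- by move=> z r Jr; apply: h4; exact: le_trans Jr.
- move=> q qJ; rewrite ler_pdivlMr// mulrC mulr_sumr; apply: le_trans h5.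
  rewrite /HH big_flatten big_map (bigD1_seq q) ?mem_iota ?iota_uniq//=.
  rewrite -[leLHS]addr0; apply: lerD; first by rewrite /H big_map.
  apply: sumr_ge0 => q' _; rewrite /H big_map; apply: sumr_ge0 => w _.
  by rewrite mulr_ge0 ?powR_ge0.
Qed.

(** Slopes and intercepts converge along a subsequence. A cheap cover of the limit slice would also
    cover the supports of late weights, against their mass; conversely, boxes met by the limit line
    are met by late lines, so cheap covers survive. *)
Lemma graph_line_slice {R : realType} (E : set R) (f : R -> R) (s t u : R) :
  seq_compact E -> eps_continuous E f -> (forall x, E x -> 0 <= x <= 1) ->
  1 < s -> 0 < u -> u + 1 < t -> ~ null box2 t (graph f E) ->
  (forall s', s < s' -> null box2 s' (graph f E)) ->
  exists m b : R, [/\ 0 <= m <= 1,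
    ~ null box1 u [set x | E x /\ f x = m * x + b]
    & forall sg, s - 1 < sg -> null box1 sg [set x | E x /\ f x = m * x + b]].
Proof.
move=> cE cf E01 s1 u0 ut nt ns.
have [B fB] := eps_continuous_bounded cE cf.
have [M [c [L [M0 c0 Lcov Lpos stages]]]] := slice_stages cE cf E01 fB s1 u0 ut nt ns.
have /choice[mm /choice[bb /choice[VV hst]]] := stages.
have c01 : seq_compact [set x : R | 0 <= x <= 1].
  apply: compact_seq_compact; rewrite (_ : [set _ | _] = `[0, 1]%classic).
    exact: segment_compact.
  by apply/seteqP; split => x /=; rewrite in_itv.
have cB : seq_compact [set x : R | `|x| <= B%:R + 1].
  apply: compact_seq_compact; rewrite (_ : [set _ | _] = `[- (B%:R + 1), (B%:R + 1)]%classic).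
    exact: segment_compact.
  by apply/seteqP; split => x /=; rewrite in_itv /= ler_norml.
have [m m01 [phi phi1 phi2]] := c01 mm (fun J => let: And5 h _ _ _ _ := hst J in h.1).
have [b bB [psi psi1 psi2]] := cB (bb \o phi) (fun J => let: And5 h _ _ _ _ := hst (phi J) in h.2).
pose chi j := phi (psi j).
have chi1 j : (j <= chi j)%N := leq_trans (psi1 j) (phi1 _).
have chim j : `|mm (chi j) - m| < j.+1%:R^-1.
  apply: lt_le_trans (phi2 (psi j)) _; rewrite lef_pV2 ?posrE// ler_nat ltnS; exact: psi1.
have chib j : `|bb (chi j) - b| < j.+1%:R^-1 := psi2 j.
have /andP[m0 m1] : 0 <= m <= 1 := m01.
exists m, b; split => //.
- move=> nF.
  have k0 : 0 < powR 4 u :> R by rewrite powR_gt0.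
  (* A cover of this cost carries mass at most c/2, while the weights have mass at least [c]. *)
  have [|p [r [r0 cov Sr]]] := nF (c / (2 * M * powR 4 u)).
    by rewrite divr_gt0// !mulr_gt0.
  (* Otherwise uncovered support points accumulate at some [y] in [E]. It lies on the limit line,
     hence inside an open box of the cover, a contradiction. *)
  have [N hN] : exists N : nat, forall J0, exists2 J, (J0 <= J)%N &
      forall v, v \in VV (chi J) -> exists2 n, (n < N)%N & `|v.1 - p n| < r n.
    apply: contrapT => no.
    have /choice[J /choice[v hv]] : forall N : nat, exists J, exists v, [/\ (N <= J)%N, v \in VV (chi J)
        & forall n, (n < N)%N -> ~ `|v.1 - p n| < r n].
      move=> N; apply: contrapT => h; apply: no; exists N => J0.
      exists (maxn J0 N); first exact: leq_maxl.
      move=> v vV; apply: contrapT => h'; apply: h; exists (maxn J0 N), v; split => //.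
        exact: leq_maxr.
      by move=> n nN hn; apply: h'; exists n.
    have EV i : E (v i).1.
      by have [_ vV _] := hv i; have [_ h _ _ _] := hst (chi (J i)); have [] := h _ vV.
    have [y Ey [th th1 th2]] := cE (fun i => (v i).1) EV.
    have Fy : f y = m * y + b.
      apply/eqP; rewrite -subr_eq0 -normr_le0; apply/ler_addgt0Pr => e e0; rewrite add0r.
      have e5 : 0 < e / 5 by rewrite divr_gt0.
      have [d d0 hd] := cf y Ey _ e5.
      have [J1 hJ1] := invS_small d0; have [J2 hJ2] := invS_small e5.
      pose j := maxn J1 J2; have j1 : (J1 <= j)%N by exact: leq_maxl.
      have j2 : (J2 <= j)%N by exact: leq_maxr.
      pose x := (v (th j)).1; pose K := J (th j).
      have Ex : E x := EV _.
      have [hK vV _] := hv (th j).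
      have Kj : (j <= K)%N := leq_trans (th1 j) hK.
      have KJ2 : K.+1%:R^-1 < e / 5 by apply: hJ2; exact: leq_trans Kj.
      have a1 := hd _ Ex (lt_trans (th2 j) (hJ1 _ j1)).
      have a2 : `|f x - mm (chi K) * x - bb (chi K)| <= e / 5.
        have [_ h _ _ _] := hst (chi K); have [_ _ hx] := h _ vV.
        apply: le_trans hx _; apply: le_trans (pow2_invS _) _; apply: ltW.
        by apply: hJ2; apply: leq_trans (chi1 K); exact: leq_trans Kj.
      have a3 : `|mm (chi K) * x - m * x| <= e / 5.
        rewrite -mulrBl normrM; have /andP[x0 x1] := E01 _ Ex; rewrite (ger0_norm x0).
        apply: le_trans (_ : `|mm (chi K) - m| <= _); first by rewrite ler_piMr.
        exact/ltW/(lt_trans (chim K)).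
      have a4 : `|m * x - m * y| <= e / 5.
        rewrite -mulrBr normrM (ger0_norm m0).
        apply: le_trans (_ : `|x - y| <= _); first by rewrite ler_piMl.
        exact/ltW/(lt_trans (th2 j))/hJ2.
      have a5 : `|bb (chi K) - b| < e / 5 := lt_trans (chib K) KJ2.
      move: a1 a2 a3 a4 a5; rewrite -/x !ler_norml !ltr_norml.
      move=> /andP[? ?] /andP[? ?] /andP[? ?] /andP[? ?] /andP[? ?].
      by apply/andP; split; lra.
    have [n _ /= hn] := cov y (conj Ey Fy).
    have [|J1 hJ1] := @invS_small R (r n - `|y - p n|); first by rewrite subr_gt0.
    pose j := maxn n.+1 J1.
    have [_ _ /(_ n)] := hv (th j); apply.
      by apply: leq_trans (th1 j); exact: leq_maxl.
    have := real_normD ((v (th j)).1 - y) (y - p n); rewrite addrA subrK.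
    have := lt_trans (th2 j) (hJ1 j (leq_maxr _ _)); lra.
  (* The mass bound holds for radii at least 2^-J; the finitely many positive radii are fixed while
     [J] grows. *)
  have [J0 hJ0] : exists J0, forall J, (J0 <= J)%N -> forall n, n \in iota 0 N ->
      0 < r n -> 2 ^- J <= r n.
    apply: eventually_list => n _; have [rn|rn] := ltP 0 (r n); last by exists 0%N.
    by have [J h] := pow2_small rn; exists J => j /h.
  have [J J0J hJ] := hN J0.
  have [_ hV1 hV2 hV3 _] := hst (chi J).
  have : \sum_(v <- VV (chi J)) v.2 <= \sum_(n < N) M * powR (4 * r n) u.
    apply: (@le_trans _ _ (\sum_(n < N) \sum_(v <- VV (chi J) | `|v.1 - p n| < r n) v.2)).
      rewrite (eq_bigr _ (fun n _ => big_mkcond _ _)) exchange_big /= !big_seq.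
      apply: ler_sum => v vV; have [n nN hn] := hJ v vV; have [_ v0 _] := hV1 _ vV.
      rewrite (bigD1 (Ordinal nN))//= hn lerDl; apply: sumr_ge0 => i _; by case: ifP.
    apply: ler_sum => n _; have := r0 n; rewrite le_eqVlt => /predU1P[rn|rn].
      rewrite big_pred0 ?mulr_ge0 ?powR_ge0 ?(ltW M0)// => v.
      by rewrite -rn ltNge normr_ge0.
    apply: hV3; apply: (hJ0 (chi J)) => //; first exact: leq_trans J0J (chi1 J).
    by rewrite mem_iota /= add0n ltn_ord.
  rewrite -mulr_sumr (eq_bigr (fun n : 'I_N => powR 4 u * powR (r n) u)); last first.
    by move=> n _; rewrite powRM.
  rewrite -mulr_sumr mulrA => h.
  have := ler_wpM2l (ltW (mulr_gt0 M0 k0)) (Sr N).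
  have -> : M * powR 4 u * (c / (2 * M * powR 4 u)) = c / 2 by field; rewrite !gt_eqF.
  by lra.
- move=> sg sg1; apply: null_of_list => //; [lra|move=> a a0].
  have [|J1 hJ1] := @invS_small R (sg - (s - 1)); first by rewrite subr_gt0.
  (* The bound by [a] is the cost wanted; the bound by 1 forces radii at most 1, so that the
     exponent can be raised to [sg]. *)
  have [|J2 hJ2] := @invS_small R (Num.min a 1 / M); first by rewrite divr_gt0// lt_min a0 ltr01.
  pose q := maxn J1 J2.
  have q1 := hJ1 q (leq_maxl _ _); have := hJ2 q (leq_maxr _ _).
  rewrite ltr_pdivlMr// mulrC lt_min => /andP[q2 q3].
  have qp : 0 < q.+1%:R^-1 :> R by rewrite invr_gt0.
  set e := q.+1%:R^-1 in q1 q2 q3 qp.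
  (* [line_met] is a strict inequality, hence stable under small changes of the line, and [L q] is
     finite. *)
  have [J hJ] : exists J, forall j, (J <= j)%N -> forall w, w \in L q ->
      line_met m b (w, 0) -> line_met (mm (chi j)) (bb (chi j)) (w, 0).
    apply: eventually_list => w _; rewrite /line_met /=.
    have [h|_] := boolP (_ < _); last by exists 0%N.
    set x := w.1.1 in h *.
    have x1 : 0 < `|x| + 1 by have := normr_ge0 x; lra.
    have [|J hJ] := @invS_small R ((2 * w.2 - `|w.1.2 - m * x - b|) / (`|x| + 1)).
      by rewrite divr_gt0// subr_gt0.
    exists J => j /hJ; rewrite ltr_pdivlMr// => hj _.
    have h1 : `|(mm (chi j) - m) * x| <= j.+1%:R^-1 * `|x|.
      by rewrite normrM ler_wpM2r// ltW.
    have := chib j; move: hj h h1; rewrite mulrDr mulr1.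
    have -> : w.1.2 - mm (chi j) * x - bb (chi j) =
      (w.1.2 - m * x - b) - ((mm (chi j) - m) * x + (bb (chi j) - b)) by ring.
    have := real_normB (w.1.2 - m * x - b) ((mm (chi j) - m) * x + (bb (chi j) - b)).
    have := real_normD ((mm (chi j) - m) * x) (bb (chi j) - b).
    set d := j.+1%:R^-1; clearbody d x; lra.
  pose j := maxn J q.+1.
  have [_ _ _ _ /(_ q)] := hst (chi j).
  rewrite (leq_trans _ (chi1 j)) ?leq_maxr// => /(_ isT) hq.
  have T : \sum_(w <- L q | line_met m b (w, 0)) powR w.2 (s - 1 + e) <= M * e.
    apply: le_trans hq; rewrite big_mkcond [leRHS]big_mkcond /= !big_seq.
    apply: ler_sum => w wL; have [h|_] := boolP (line_met m b _).
      by rewrite (hJ j (leq_maxl _ _) w wL h).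
    by case: ifP; rewrite ?powR_ge0.
  (* The boxes met by the limit line, projected to the first axis, cover the slice. *)
  exists [seq (w.1.1, w.2) | w <- L q & line_met m b (w, 0)]; split.
  + by move=> _ /mapP[w + ->] /=; rewrite mem_filter => /andP[_ wL]; exact/ltW/(Lpos q).
  + move=> x [Ex fx]; have [w wL [/= h1 h2]] := Lcov q x Ex.
    exists (w.1.1, w.2) => //; apply: (map_f (fun w : R * R * R => (w.1.1, w.2))).
    rewrite mem_filter wL andbT /line_met /=.
    have -> : w.1.2 - m * w.1.1 - b = - (f x - w.1.2) + m * (x - w.1.1) by rewrite fx; ring.
    apply: le_lt_trans (real_normD _ _) _; rewrite normrN normrM (ger0_norm m0).
    have : m * `|x - w.1.1| <= `|x - w.1.1| by rewrite ler_piMl.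
    by lra.
  + rewrite big_map big_filter /=; apply: le_trans (ltW q2); apply: (le_trans _ T).
    rewrite big_seq_cond [leRHS]big_seq_cond; apply: ler_sum => w /andP[wL wm].
    apply: powR_anti; [|lra|lra|lra].
    have w0 := Lpos q w wL; apply/andP; split; first exact: ltW.
    apply: (@powR_le1 _ _ (s - 1 + e)); [lra|exact: ltW|].
    apply: le_trans (ltW q3); apply: (le_trans _ T).
    by rewrite (big_rem w wL) /= wm lerDl; apply: sumr_ge0 => ? _; exact: powR_ge0.
Qed.

(** * Gluing slices around the regular point *)

Lemma hausdorff_dim_null {R : realType} {T : Type} (d : T -> T -> R) (b : T -> R -> set T)
    (s t : R) (A : set T) :
  inhabited T -> (forall x y, 0 <= d x y) -> (forall p r x, d p x < r -> b p r x) ->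
  0 < t -> s < t -> hausdorff_dim d A = s%:E -> null b t A.
Proof.
move=> iT d0 db t0 st dA.
have : (hausdorff_dim d A < t%:E)%E by rewrite dA lte_fin.
move=> /ereal_inf_lt[_ [a [a0 Ha] <-]]; rewrite lte_fin => at_.
exact: (hausdorff_measure_null iT d0 db a0 (ltW at_) t0 Ha).
Qed.

Lemma null_hausdorff_dim {R : realType} {T : Type} (d : T -> T -> R) (b : T -> R -> set T)
    (t : R) (A : set T) :
  (forall x y, 0 <= d x y) -> (forall p r x y, b p r x -> b p r y -> d x y <= 4 * r) ->
  0 < t -> null b t A -> (hausdorff_dim d A <= t%:E)%E.
Proof.
move=> d0 bd t0 nA; apply: ereal_inf_lbound; exists t => //; split; first exact: ltW.
exact: null_hausdorff_measure nA.
Qed.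

(** * Comparison of the metrics with boxes *)

Lemma dist1_ge0 {R : realType} (x y : R) : 0 <= dist1 x y.
Proof. exact: normr_ge0. Qed.

Lemma dist1_box {R : realType} (p r x : R) : dist1 p x < r -> box1 p r x.
Proof. by rewrite /dist1 distrC. Qed.

Lemma box1_dist {R : realType} (p r x y : R) : box1 p r x -> box1 p r y -> dist1 x y <= 4 * r.
Proof.
rewrite /box1 /dist1 /= !ltr_norml ler_norml => /andP[? ?] /andP[? ?].
by apply/andP; split; lra.
Qed.

Lemma dist2_ge0 {R : realType} (x y : R * R) : 0 <= dist2 x y.
Proof. exact: sqrtr_ge0. Qed.

Lemma dist2_box {R : realType} (p : R * R) (r : R) (x : R * R) : dist2 p x < r -> box2 p r x.
Proof.
move=> h; split; apply: le_lt_trans h; rewrite distrC -sqrtr_sqr ler_wsqrtr//.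
  by rewrite lerDl sqr_ge0.
by rewrite lerDr sqr_ge0.
Qed.

Lemma box2_dist {R : realType} (p : R * R) (r : R) (x y : R * R) :
  box2 p r x -> box2 p r y -> dist2 x y <= 4 * r.
Proof.
move=> [x1 x2] [y1 y2]; have := box1_dist x1 y1; have := box1_dist x2 y2.
have r0 : 0 < r by apply: le_lt_trans x1.
have a1 : `|x.1 - y.1| < 2 * r.
  by move: x1 y1; rewrite !ltr_norml => /andP[? ?] /andP[? ?]; apply/andP; split; lra.
have a2 : `|x.2 - y.2| < 2 * r.
  by move: x2 y2; rewrite !ltr_norml => /andP[? ?] /andP[? ?]; apply/andP; split; lra.
move=> _ _; rewrite /dist2 -(@ler_sqr R) ?nnegrE ?sqrtr_ge0 ?mulr_ge0 ?(ltW r0)//.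
rewrite sqr_sqrtr ?addr_ge0 ?sqr_ge0// -(real_normK (num_real (x.1 - y.1))).
rewrite -(real_normK (num_real (x.2 - y.2))).
have h (a : R) : 0 <= a -> a < 2 * r -> a ^+ 2 <= 4 * r ^+ 2.
  move=> a0 ar; have -> : 4 * r ^+ 2 = (2 * r) ^+ 2 by ring.
  by rewrite ler_sqr ?nnegrE// ?mulr_ge0// ltW.
have := h _ (normr_ge0 _) a1; have := h _ (normr_ge0 _) a2.
have : 0 <= r ^+ 2 by rewrite sqr_ge0.
have -> : (4 * r) ^+ 2 = 16 * r ^+ 2 by ring.
by lra.
Qed.

(** The cone condition is cleared of its denominator, and both radii are included so that shells are
    closed in [K]; neighbouring shells may share boundary points. *)
Definition shell {R : realType} (K : set R) (f : R -> R) (x0 beta : R) (n : nat) : set R :=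
  [set x | [/\ K x, 2 ^- n.+1 <= `|x - x0| <= 2 ^- n & `|f x - f x0| <= beta * `|x - x0|]].

Lemma shell_limit {R : realType} (K : set R) (f : R -> R) (x0 beta : R) n y :
  0 <= beta -> K y ->
  (forall e, 0 < e -> exists2 x, shell K f x0 beta n x & `|x - y| < e /\ `|f x - f y| < e) ->
  shell K f x0 beta n y.
Proof.
move=> b0 Ky h; split => //.
  apply/andP; split; apply/ler_addgt0Pr => e e0; have [x [_ /andP[x1 x2] _] [xy _]] := h e e0.
    have := real_normD (x - y) (y - x0); rewrite addrA subrK; lra.
  have h1 := real_normD (y - x) (x - x0); rewrite addrA subrK (distrC y x) in h1; lra.
apply/ler_addgt0Pr => e e0.
have b2 : 0 < beta + 1 by lra.
have [x [_ _ hx] [xy fxy]] := h (e / (beta + 1)) (divr_gt0 e0 b2).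
have h1 := real_normD (f y - f x) (f x - f x0); rewrite addrA subrK (distrC (f y) (f x)) in h1.
have h2 := real_normD (x - y) (y - x0); rewrite addrA subrK in h2.
have h3 := ler_wpM2l b0 h2.
have h4 : beta * `|x - y| <= beta * (e / (beta + 1)) by rewrite ler_wpM2l// ltW.
have h5 : beta * (e / (beta + 1)) + e / (beta + 1) = e by field; rewrite gt_eqF.
by move: h3; rewrite mulrDr; lra.
Qed.

Lemma seq_compact_shell {R : realType} (K : set R) (f : R -> R) (x0 beta : R) n :
  0 <= beta -> seq_compact K -> eps_continuous K f -> seq_compact (shell K f x0 beta n).
Proof.
move=> b0 cK cf x xS; have xK i : K (x i) by have [] := xS i.
have [y Ky [phi p1 p2]] := cK x xK; exists y; last by exists phi.
apply: shell_limit => // e e0; have [d d0 hd] := cf y Ky e e0.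
have [J1 hJ1] := invS_small d0; have [J2 hJ2] := invS_small e0.
pose j := maxn J1 J2; exists (x (phi j)) => //; split.
  by apply: lt_trans (p2 j) _; apply: hJ2; exact: leq_maxr.
by apply: hd => //; apply: lt_trans (p2 j) _; apply: hJ1; exact: leq_maxl.
Qed.

(** Skipping one shell leaves a factor 2 between the distances to [x0], so the distance between the
    points controls both. *)
Lemma shell_separation {R : realType} (K : set R) (f : R -> R) (x0 beta : R) n n' x y :
  (n.+2 <= n')%N -> shell K f x0 beta n x -> shell K f x0 beta n' y ->
  `|y - x0| <= `|x - x0| / 2 /\ `|x - x0| <= 2 * `|x - y|.
Proof.
move=> nn [_ /andP[x1 x2] _] [_ /andP[y1 y2] _].
have h : 2 ^- n' <= 2 ^- n.+2 :> R by rewrite lef_pV2 ?posrE ?exprn_gt0// ler_weXn2l ?ler1n.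
have e : 2 ^- n.+2 = 2 ^- n.+1 / 2 :> R by rewrite [2 ^+ n.+2]exprS invfM mulrC.
have a : `|y - x0| <= `|x - x0| / 2 by lra.
split => //; have := real_normD (x - y) (y - x0); rewrite addrA subrK; lra.
Qed.

(** If all shells from [n0] on had null graphs, so would their union, which contains the part of the
    cone over a ball around [x0]; its dimension would be at most [t < s]. *)
Lemma shell_not_null {R : realType} (K : set R) (f : R -> R) (s t x0 beta : R) n0 :
  0 < t -> t < s -> dimH2 (graph f K) = s%:E -> beta_regular_fd_point K f x0 beta ->
  exists2 n, (n0 <= n)%N & ~ null box2 t (graph f (shell K f x0 beta n)).
Proof.
move=> t0 ts dK [Kx0 /(_ (2 ^- n0))]; rewrite invr_gt0 exprn_gt0// => /(_ isT) hr.
apply: contrapT => no.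
have nn n : null box2 t (graph f (shell K f x0 beta (n0 + n))).
  by apply: contrapT => h; apply: no; exists (n0 + n)%N => //; exact: leq_addr.
have nU := null_bigcup (inhabits (0, 0)) t0 nn.
suff : (s%:E <= t%:E)%E by rewrite lee_fin leNgt ts.
rewrite -dK -hr; apply: (null_hausdorff_dim (@dist2_ge0 R) (@box2_dist R) t0).
apply: (null_subset _ nU) => p [/= [px0 pb] [x [Kx xr] xE]]; rewrite -xE /= in px0 pb *.
have xp : 0 < `|x - x0| by rewrite normr_gt0 subr_eq0.
have x1 : `|x - x0| <= 1.
  by rewrite (le_trans (ltW xr))// invf_le1 ?exprn_gt0// exprn_ege1// ler1n.
have [|n /andP[n1 n2]] := @dyadic_scale R `|x - x0|; first by rewrite xp.
have nn0 : (n0 <= n)%N.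
  rewrite leqNgt; apply/negP => h.
  have : 2 ^- n0 <= 2 ^- n.+1 :> R by rewrite lef_pV2 ?posrE ?exprn_gt0// ler_weXn2l ?ler1n.
  by move: xr; rewrite /oball /=; lra.
exists (n - n0)%N => //; exists x => //; rewrite subnKC//; split => //.
  by rewrite n2 (ltW n1).
by move: pb; rewrite normrM normfV ler_pdivrMr.
Qed.

Lemma null_set1 {R : realType} (x t : R) : 0 < t -> null box1 t [set x].
Proof.
move=> t0; apply: null_of_list => // c c0; exists [:: (x, powR c t^-1)]; split.
- by move=> u; rewrite inE => /eqP -> /=; exact: powR_ge0.
- move=> _ ->; exists (x, powR c t^-1); first exact: mem_head.
  by rewrite /box1 /= subrr normr0 powR_gt0.
- by rewrite big_seq1 /= powRVK ?gt_eqF// ltW.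
Qed.

(** * The union of slices and its properties *)

Theorem theorem3p7 (R : realType) (s : R) (K : set R) (f : R -> R) :
  1 < s -> s <= 2 ->
  compact K -> K `<=` [set x : R | 0 <= x <= 1] ->
  H_s s K f -> regular_full_dimensional K f ->
  exists F : set R,
    [/\ compact F, F `<=` K, dimH1 F = (s - 1)%:E & lipschitz_on_set F f].
Proof.
move=> s1 _ cK K01 [contf dK] [beta [beta0 [x0 reg]]].
have scK := compact_seq_compact cK; have cf := within_eps_continuous contf.
have Kx0 : K x0 by case: reg.
pose S n := shell K f x0 beta n.
have cfS n : eps_continuous (S n) f.
  move=> x [Kx _ _] e e0; have [d d0 hd] := cf x Kx e e0.
  by exists d => // y [Ky _ _]; exact: hd.
have nS n s' : s < s' -> null box2 s' (graph f (S n)).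
  move=> ss'; apply: (@null_subset _ _ _ _ _ (graph f K)).
    by move=> _ [x [Kx _ _] <-]; exists x.
  apply: (hausdorff_dim_null (inhabits (0, 0)) (@dist2_ge0 R) (@dist2_box R) _ ss' dK); lra.
(* Exponents increasing to [s - 1]; the shift by 2 makes [u 0] positive. *)
pose u (k : nat) : R := (s - 1) * (1 - k.+2%:R^-1).
have u0 k : 0 < u k /\ u k < s - 1.
  have h0 : 0 < k.+2%:R^-1 :> R by rewrite invr_gt0.
  have h1 : k.+2%:R^-1 < 1 :> R by rewrite invf_lt1// ltr1n.
  rewrite /u; move: (_^-1) h0 h1 => w h0 h1.
  by split; [rewrite mulr_gt0//; lra|rewrite gtr_pMr; lra].
have slices : forall a : nat * nat, exists n : nat, exists m b : R, [/\ (a.2 <= n)%N, 0 <= m <= 1,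
    ~ null box1 (u a.1) [set x | S n x /\ f x = m * x + b]
    & forall sg, s - 1 < sg -> null box1 sg [set x | S n x /\ f x = m * x + b]].
  move=> [k n0] /=; have [uk0 uk1] := u0 k.
  (* The exponent is the midpoint of [u k + 1] and [s]: above the first for slicing, below the
     second for a shell to be non-null. *)
  have [||n nn0 nn] := @shell_not_null R K f s ((u k + (s - 1)) / 2 + 1) x0 beta n0 _ _ dK reg.
  - by lra.
  - by lra.
  have [||m [b [m01 h1 h2]]] := @graph_line_slice R (S n) f s ((u k + (s - 1)) / 2 + 1) (u k)
    (@seq_compact_shell _ K f x0 beta n (ltW beta0) scK cf) (cfS n) _ s1 uk0 _ nn (nS n).
  - by move=> x [/K01].
  - by lra.
  by exists n, m, b.
have {slices} /choice[N /choice[m /choice[b hN]]] := slices.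
(* Each new shell is taken at least two scales after the previous one, as the separation
   requires. *)
pose nn := fix nn k := if k is j.+1 then N (k, (nn j).+2) else N (0, 0)%N.
pose idx k := if k is j.+1 then (k, (nn j).+2) else (0, 0)%N.
have nnE k : nn k = N (idx k) by case: k.
have idx1 k : (idx k).1 = k by case: k.
have nnS k : ((nn k).+2 <= nn k.+1)%N by have [h _ _ _] := hN (k.+1, (nn k).+2).
have nn_lt k l : (k < l)%N -> ((nn k).+2 <= nn l)%N.
  elim: l => // l IH; rewrite ltnS leq_eqVlt => /predU1P[->//|/IH h].
  by apply: leq_trans h _; apply: leq_trans (nnS l); lia.
pose Fk k := [set x | S (nn k) x /\ f x = m (idx k) * x + b (idx k)].
have m01 k : 0 <= m (idx k) <= 1 by have [_ h _ _] := hN (idx k).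
have Fk1 k : ~ null box1 (u k) (Fk k).
  by have [_ _ h _] := hN (idx k); rewrite -nnE idx1 in h.
have Fk2 k sg : s - 1 < sg -> null box1 sg (Fk k).
  by have [_ _ _ h] := hN (idx k); rewrite -nnE in h; exact: h.
(* The point [x0] is added because the slices accumulate there. *)
pose A k := if k is j.+1 then Fk j else [set x0].
pose F := \bigcup_k A k.
have FK : F `<=` K by move=> x [[|k] _ /=]; [move=> ->|case=> -[]].
(* The cone bounds |f x - f y| by [beta] times the sum of the distances to [x0], and separation
   bounds that sum by [3 * |x - y|]. *)
have lipk k l x y : (k < l)%N -> Fk k x -> Fk l y -> `|f x - f y| <= 4 * beta * `|x - y|.
  move=> kl [Sx _] [Sy _]; have [h1 h2] := shell_separation (nn_lt _ _ kl) Sx Sy.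
  have [_ _ fx] := Sx; have [_ _ fy] := Sy.
  have := real_normB (f x - f x0) (f y - f x0).
  have -> : f x - f x0 - (f y - f x0) = f x - f y by ring.
  have a1 : beta * `|y - x0| <= beta * (`|x - x0| / 2) by rewrite ler_pM2l.
  have a2 : beta * `|x - x0| <= beta * (2 * `|x - y|) by rewrite ler_pM2l.
  have : 0 <= beta * `|x - x0| by rewrite mulr_ge0// ltW.
  by lra.
have lip0 k x : Fk k x -> `|f x - f x0| <= (1 + 4 * beta) * `|x - x0|.
  move=> [[_ _ h] _]; have : 0 <= beta * `|x - x0| by rewrite mulr_ge0// ltW.
  by have := normr_ge0 (x - x0); lra.
exists F; split => //.
- apply: (@subclosed_compact _ _ K) => // y cly.
  have Ky : K y by apply: (compact_closed (@Rhausdorff R) cK); exact: closure_subset FK _ cly.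
  have near_y e : 0 < e -> exists2 x, F x & `|x - y| < e /\ `|f x - f y| < e.
    move=> e0; have [d d0 hd] := cf y Ky e e0.
    have [|x [Fx]] := cly (ball y (Num.min d e)).
      by apply: nbhsx_ballx; rewrite lt_min d0.
    rewrite /ball /= distrC lt_min => /andP[xd xe].
    by exists x => //; split => //; apply: hd => //; exact: FK.
  have [->|yx0] := eqVneq y x0; first by exists 0%N.
  have yp : 0 < `|y - x0| by rewrite normr_gt0 subr_eq0.
  (* Within this radius of [y] only one slice can appear: points of two different slices would be
     too close for the separation. *)
  have dp : 0 < `|y - x0| / 8 by rewrite divr_gt0.
  have far x : `|x - y| < `|y - x0| / 8 -> `|y - x0| / 2 < `|x - x0|.
    by move=> h; have := real_normD (y - x) (x - x0); rewrite addrA subrK (distrC y x); lra.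
  have Fnear x : F x -> `|x - y| < `|y - x0| / 8 -> exists k, Fk k x.
    move=> [[|k] _ /= Ax] /far; last by exists k.
    by rewrite Ax subrr normr0; lra.
  have [x1 Fx1 [x1y _]] := near_y _ dp; have [k Fk_x1] := Fnear _ Fx1 x1y.
  have sep i j x x' : (i < j)%N -> Fk i x -> Fk j x' -> `|x - y| < `|y - x0| / 8 ->
      `|x' - y| < `|y - x0| / 8 -> False.
    move=> ij [Sx _] [Sx' _] h h'; have [_ h2] := shell_separation (nn_lt _ _ ij) Sx Sx'.
    have := far _ h; have := real_normD (x - y) (y - x').
    by rewrite addrA subrK (distrC y x'); lra.
  have near_k e : 0 < e -> exists2 x, Fk k x & `|x - y| < e /\ `|f x - f y| < e.
    move=> e0; have [|x Fx] := near_y (Num.min e (`|y - x0| / 8)); first by rewrite lt_min e0.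
    rewrite !lt_min => -[/andP[h1 h2] /andP[h3 _]].
    have [l Fl] := Fnear x Fx h2; exists x => //.
    by case: (ltngtP l k) => [lk|kl|<-//]; exfalso; [exact: sep lk Fl Fk_x1 h2 x1y|
      exact: sep kl Fk_x1 Fl x1y h2].
  exists k.+1 => //; split.
    apply: shell_limit => //; first exact: ltW.
    by move=> e /near_k[x [Sx _] h]; exists x.
  apply/eqP; rewrite -subr_eq0 -normr_le0; apply/ler_addgt0Pr => e e0; rewrite add0r.
  have [x [_ fx] [h1 h2]] := near_k (e / 2) (divr_gt0 e0 (ltr0Sn _ _)).
  have /andP[m0 m1] := m01 k.
  have -> : f y - (m (idx k) * y + b (idx k)) = - (f x - f y) + m (idx k) * (x - y).
    by rewrite fx; ring.
  apply: le_trans (real_normD _ _) _; rewrite normrN normrM (ger0_norm m0).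
  have : m (idx k) * `|x - y| <= `|x - y| by rewrite ler_piMl.
  by lra.
- apply/eqP; rewrite eq_le; apply/andP; split.
    apply/lee_addgt0Pr => e e0; rewrite -EFinD.
    have e1 : 0 < s - 1 + e by lra.
    apply: (null_hausdorff_dim (@dist1_ge0 R) (@box1_dist R) e1).
    apply: null_bigcup => // -[|k]; first exact: null_set1.
    by apply: Fk2; lra.
  (* An exponent [a < s - 1] lies below some [u J], and the slice [Fk J] is not null at [u J]. *)
  apply/ereal_infP => _ [a [a0 Ha] <-]; rewrite lee_fin leNgt; apply/negP => as_.
  have s10 : 0 < s - 1 by lra.
  have [|J hJ] := @invS_small R ((s - 1 - a) / (s - 1)); first by rewrite divr_gt0// subr_gt0.
  have uJ : a < u J.
    have := hJ J.+1 (leqnSn J); rewrite ltr_pdivlMr// => h.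
    by rewrite /u mulrBr mulr1 mulrC; move: (_^-1 * _) h => w h; lra.
  apply: (Fk1 J); have [uJ0 _] := u0 J.
  have FJ : Fk J `<=` F by move=> x Fx; exists J.+1.
  apply: (null_subset FJ).
  exact: (hausdorff_measure_null (inhabits 0) (@dist1_ge0 R) (@dist1_box R) a0 (ltW uJ) uJ0 Ha).
(* Slopes are at most 1 within a slice, [4 * beta] serves for two slices, and the cone condition for
   pairs with [x0]. *)
- exists (1 + 4 * beta) => x y [[|k] _ /= Ax] [[|l] _ /= Ay].
  + by rewrite Ax Ay !subrr normr0 mulr0.
  + by rewrite Ax distrC (distrC x0); exact: lip0 Ay.
  + by rewrite Ay; exact: lip0 Ax.
  + have b4 : 4 * beta * `|x - y| <= (1 + 4 * beta) * `|x - y|.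
      by have := normr_ge0 (x - y); rewrite mulrDl; lra.
    case: (ltngtP k l) => [kl|lk|kl].
    * exact: le_trans (lipk _ _ _ _ kl Ax Ay) b4.
    * by rewrite distrC (le_trans (lipk _ _ _ _ lk Ay Ax))// distrC.
    * rewrite kl in Ax; case: Ax => _ ->; case: Ay => _ ->.
      have /andP[m0 m1] := m01 l.
      have -> : m (idx l) * x + b (idx l) - (m (idx l) * y + b (idx l)) = m (idx l) * (x - y) by ring.
      rewrite normrM (ger0_norm m0) ler_wpM2r//; lra.
Qed.
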